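(* For every $n\ge 2$ the genus distribution of ${\cal S}_9^n$ is unimodal, and its peak $p_9(n)$ is $$p_9(n)=\begin{cases}\Big[\dfrac{n+1}{2}\Big], & 2\le n\le 8,\\[2mm] 4, & n=9,\\[1mm] \Big[\dfrac{n}{3}\Big]+2, & n\ge 10.\end{cases}$$
   Context: $[x]$ denotes the largest integer not exceeding $x$. A surface is represented by a cyclic word in which every occurring letter $x$ appears exactly once as $x$ and exactly once as $x^-$; it is the closed orientable surface obtained from a polygon with boundary labelled by the word by identifying each side $x$ with the side $x^-$ (orientation reversed), and its genus is the genus of that surface. Let $a,b,a_1,a_2,\dots$ be distinct letters. For $n\ge 1$ and subsets $K,T\subseteq\{1,\dots,n\}$ put: $R_1^n$ = product of the letters $a_k$, $k\in K$, in decreasing order of index; $R_2^n$ = product of the $a_k$, $k\notin K$, in increasing order of index; $R_3^n$ = product of the $a_t^-$, $t\in T$, in decreasing order of index; $R_4^n$ = product of the $a_t^-$, $t\notin T$, in increasing order of index. The set of ladder surfaces considered is ${\cal S}_9^n=\{R_1^nR_3^naR_2^na^-bR_4^nb^-\}$, where $(K,T)$ runs over all $4^n$ pairs of subsets and surfaces are counted with multiplicity (one for each pair). $g_{i_9}(n)$ is the number of surfaces of genus $i$ in ${\cal S}_9^n$, and the genus distribution of ${\cal S}_9^n$ is the sequence $(g_{i_9}(n))_i$, with $i$ running from the minimum to the maximum genus of surfaces in ${\cal S}_9^n$. A finite sequence of nonnegative numbers $\{a_i\}_{i=q}^n$ is unimodal if $a_q\le\cdots\le a_{l-1}<a_l=\cdots=a_m>a_{m+1}\ge\cdots\ge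 a_n$ for some $q\le l\le m\le n$; $l,\dots,m$ are its modes, and if $l=m$ then $m$ is called the peak (indices are genera). *)

(* Defs.v *)
From mathcomp Require Import all_boot.
From mathcomp Require Import zify.

Set Implicit Arguments.
Unset Strict Implicit.
Unset Printing Implicit Defensive.

(* An oriented letter (x, false) stands for x and (x, true) for x^-. *)
Definition inv_letter (L : Type) (s : L * bool) : L * bool := (s.1, ~~ s.2).

(* Every occurring letter x appears exactly once as x and exactly once as x^-. *)
Definition surface_word (L : eqType) (w : seq (L * bool)) : bool :=
  uniq w && all (fun s => inv_letter s \in w) w.

(* The word w labels the sides of a polygon with (size w) sides, read          *)
(* cyclically: side number i runs from corner i to corner ordS i.  If sides i  *)
(* and j carry x and x^-, the reversing identification of the two sides glues  *)
(* corner i to corner (ordS j), and corner (ordS i) to corner j.               *)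
Definition glued_sides (L : eqType) (w : seq (L * bool)) : rel 'I_(size w) :=
  fun i j => tnth (in_tuple w) j == inv_letter (tnth (in_tuple w) i).

Definition glued_corners (L : eqType) (w : seq (L * bool)) :
    rel 'I_(size w) :=
  fun c d => [exists i, exists j, glued_sides i j &&
    (((c == i) && (d == ordS j)) || ((c == ordS i) && (d == j)))].

Definition num_vertices (L : eqType) (w : seq (L * bool)) : nat :=
  n_comp (@glued_corners L w) predT.

Definition num_edges (L : eqType) (w : seq (L * bool)) : nat := (size w)./2.

(* The polygon is the only face, so V - E + 1 = 2 - 2 g.  For a surface_word   *)
(* E + 1 - V is a nonnegative even number, and neither the subtraction nor the *)
(* halving loses anything.                                                     *)
Definition genus (L : eqType) (w : seq (L * bool)) : nat :=
  ((num_edges w).+1 - num_vertices w)./2.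

(* inl k is the letter a_(k+1), as 'I_n is indexed from 0. *)
Definition letter (n : nat) : finType := ('I_n + bool)%type.

Definition let_ak n (k : 'I_n) : letter n := inl k.
Definition let_a n : letter n := inr false.
Definition let_b n : letter n := inr true.

(* The enumeration (enum A) of A : {set 'I_n} is increasing. *)
Definition R1 n (K : {set 'I_n}) : seq (letter n * bool) :=
  [seq (let_ak k, false) | k <- rev (enum K)].
Definition R2 n (K : {set 'I_n}) : seq (letter n * bool) :=
  [seq (let_ak k, false) | k <- enum (~: K)].
Definition R3 n (T : {set 'I_n}) : seq (letter n * bool) :=
  [seq (let_ak t, true) | t <- rev (enum T)].
Definition R4 n (T : {set 'I_n}) : seq (letter n * bool) :=
  [seq (let_ak t, true) | t <- enum (~: T)].

Definition ladder9 n (KT : {set 'I_n} * {set 'I_n}) : seq (letter n * bool) :=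
  R1 KT.1 ++ R3 KT.2 ++ [:: (let_a n, false)] ++ R2 KT.1
    ++ [:: (let_a n, true); (let_b n, false)] ++ R4 KT.2
    ++ [:: (let_b n, true)].

Lemma ladder9_surface n (KT : {set 'I_n} * {set 'I_n}) :
  surface_word (ladder9 KT).
Proof.
case: KT => K T; rewrite /surface_word.
have inK e s (A : {set 'I_n}) : (s \in [seq (let_ak k, e) | k <- enum A]) =
    (if s is (inl k, e') then (k \in A) && (e' == e) else false).
  case: s => -[k|c] e' /=; last by apply/mapP => -[].
  apply/mapP/andP => [[k']|[kA /eqP->]]; last by exists k; rewrite ?mem_enum.
  by rewrite mem_enum => kA [-> ->].
have inE1 s : (s \in ladder9 (K, T)).
  case: s => -[k|c] e; rewrite /ladder9 /R1 /R2 /R3 /R4 /= !map_rev;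
    rewrite !(mem_cat, inE, mem_rev, inK) /=.
    by case: e; case: (k \in K); case: (k \in T); rewrite ?orbT.
  by case: c; case: e; rewrite ?orbT.
apply/andP; split; last by apply/allP.
apply/card_uniqP; rewrite (eq_card (B := {: letter n * bool})) //.
rewrite /ladder9 /R1 /R2 /R3 /R4 !(size_cat, size_map, size_rev) /= -!cardE.
rewrite card_prod card_sum card_bool card_ord.
have := cardsC K; have := cardsC T; rewrite !card_ord.
by move: #|K| #|~: K| #|T| #|~: T| => k k' t t'; lia.
Qed.

Definition g9 (n i : nat) : nat :=
  #|[set KT : {set 'I_n} * {set 'I_n} | genus (ladder9 KT) == i]|.

Definition min_genus9 (n : nat) : nat :=
  genus (ladder9 [arg min_(KT < (set0, set0) : {set 'I_n} * {set 'I_n})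
                    genus (ladder9 KT)]).

Definition max_genus9 (n : nat) : nat :=
  genus (ladder9 [arg max_(KT > (set0, set0) : {set 'I_n} * {set 'I_n})
                    genus (ladder9 KT)]).

(* f q <= ... <= f (l-1) < f l = ... = f m > f (m+1) >= ... >= f r *)
Definition modes_of (f : nat -> nat) (q r l m : nat) : Prop :=
  [/\ [/\ q <= l, l <= m & m <= r],
      (forall i, q <= i -> i.+1 < l -> f i <= f i.+1)
        /\ (q < l -> f l.-1 < f l),
      forall i, l <= i -> i <= m -> f i = f l &
      (m < r -> f m.+1 < f m)
        /\ (forall i, m < i -> i < r -> f i.+1 <= f i)].

Definition unimodal (f : nat -> nat) (q r : nat) : Prop :=
  exists l m, modes_of f q r l m.

Definition is_peak (f : nat -> nat) (q r p : nat) : Prop :=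
  modes_of f q r p p.

Definition p9 (n : nat) : nat :=
  if n <= 8 then n.+1 %/ 2 else if n == 9 then 4 else n %/ 3 + 2.

(* Main.v *)
Require Import Defs.
From Stdlib Require Import ZArith.
From mathcomp Require Import all_boot all_order all_algebra.
From mathcomp Require Import zify ring ssrZ.

(* Insert the pairs a_k, a_k^- one after the other, for k = 1, ..., n.  The    *)
(* vertices are the cycles of (successor in the word) o (inverse letter), and  *)
(* such an insertion cuts these cycles at two corners and reconnects them      *)
(* crosswise.  So it either splits a vertex, which keeps the genus, or merges  *)
(* two vertices, which raises it by one.  Which of the two happens depends     *)
(* only on the cyclic order in which the vertices visit the four places of     *)
(* R_1, R_2, R_3, R_4 where the next letters go.  This gives an automaton with *)
(* 24 states, whose generating function is, with X marking the genus,          *)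
(*   6 X^2 L_2(n) + 6 X (1 - X) L_1(n) + D(n),                                 *)
(* where L_c(0) = 0, L_c(1) = 1, L_c(n+2) = c L_c(n+1) + 8 X L_c(n), and D(n)  *)
(* only has terms of degree about n/2.  Hence, with k = n - 1 and              *)
(* c_j = binomial (k - j) j, the coefficient of X^(j+2) is                     *)
(*   6 8^j ((2^(k-2j) - 1) c_j + 8 c_(j+1)) + (coefficient of D(n)).           *)
(* As (j+1) (k-j) c_(j+1) = (k-2j) (k-2j-1) c_j, the dominant part 2^(k+j) c_j *)
(* increases exactly while 3j + 2 <= k, and for n >= 32 this determines the    *)
(* sign of every difference; n < 32 is a computation.                          *)

Set Implicit Arguments.
Unset Strict Implicit.
Unset Printing Implicit Defensive.

Import GRing.Theory Num.Theory.

(** * Cyclic words and vertex cycles *)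

(** Every ladder word arises from [a a^- b b^-] by [n] insertions of a letter together with its
    inverse. Each insertion adds one edge and either splits a vertex ([insert_split]) or merges two
    ([insert_merge]), so by Euler's formula the genus is the number of merges. Self-inverse markers
    keep the four open places visible in the vertex cycles. [trans_okP] checks by computation that
    the arrangement of the markers decides each step, and [genus_ladder9] reads the genus off the
    run of this automaton.

    The pairs of subsets are exactly the choice sequences of length [n], so the genus polynomial is
    a weighted count of paths. Lumping the states into 13 classes and solving the linear recurrences
    gives [class_poly0], whose coefficients are read off in [g9_SS].

    For [n >= 32], [excess_inc] and [excess_dec] compare consecutive main terms through ratios of
    binomials; the remainder [small_part] vanishes where a rise is claimed and is outweighed where a
    fall is claimed. The other rows are evaluated ([peaked_small]). Monotonicity is obtained over
    all genera; as the value at the peak is positive, the peak lies between the extreme genera. *)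

Section Links.
Variable T : eqType.
Implicit Types (u v w : seq T).

Definition links (s : seq T) : seq (T * T) := zip s (behead s).
Definition clinks (s : seq T) : seq (T * T) :=
  if s is q :: u then links (q :: rcons u q) else [::].

Arguments links : simpl never.
Arguments clinks : simpl never.

Lemma links_cat q u s v :
  links (q :: u ++ s :: v) = links (q :: u) ++ (last q u, s) :: links (s :: v).
Proof.
elim: u q => [|r u IH] q //=.
by rewrite [LHS]/links /= -/(links (r :: u ++ s :: v)) IH.
Qed.

Lemma clinks_cons q u : clinks (q :: u) = links (q :: u) ++ [:: (last q u, q)].
Proof. by rewrite /clinks -cats1 links_cat. Qed.

Lemma clinks_cat q u s v :
  clinks (q :: u ++ s :: v) =
  links (q :: u) ++ (last q u, s) :: links (s :: v) ++ [:: (last s v, q)].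
Proof. by rewrite clinks_cons links_cat last_cat -catA. Qed.

Lemma perm_clinks_catC u v : perm_eq (clinks (u ++ v)) (clinks (v ++ u)).
Proof.
case: u => [|q u]; first by rewrite cats0.
case: v => [|s v]; first by rewrite cats0.
rewrite !cat_cons !clinks_cat.
rewrite -cat_rcons -[X in perm_eq _ X]cat_rcons.
rewrite -!cats1 perm_catC.
by apply/permP => p; rewrite !count_cat.
Qed.

Lemma clinks_zip (s : seq T) : clinks s = zip s (rot 1 s).
Proof.
case: s => [|q u] //; rewrite rot1_cons /clinks /links /=.
have aux p r : zip (r :: rcons u p) (rcons u p) = zip (r :: u) (rcons u p).
  by elim: u r => //= t u IH r; rewrite IH.
exact: aux.
Qed.

Lemma unzip1_clinks (s : seq T) : unzip1 (clinks s) = s.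
Proof. by rewrite clinks_zip unzip1_zip // size_rot. Qed.

Lemma unzip2_clinks (s : seq T) : unzip2 (clinks s) = rot 1 s.
Proof. by rewrite clinks_zip unzip2_zip // size_rot. Qed.

Lemma clinks_fun (s : seq T) a b c : uniq s ->
  (a, b) \in clinks s -> (a, c) \in clinks s -> b = c.
Proof.
move=> us; have : uniq (unzip1 (clinks s)) by rewrite unzip1_clinks.
elim: (clinks s) => //= -[d e] l IH /andP[dl ul].
rewrite !inE => /orP[/eqP e1|h1] /orP[/eqP e2|h2].
- by case: e1 e2 => _ -> [].
- by case/negP: dl; case: e1 => <- _; apply/mapP; exists (a, c).
- by case/negP: dl; case: e2 => <- _; apply/mapP; exists (a, b).
exact: IH.
Qed.

Lemma clinks_inj (s : seq T) a b c : uniq s ->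
  (a, c) \in clinks s -> (b, c) \in clinks s -> a = b.
Proof.
move=> us; have : uniq (unzip2 (clinks s)) by rewrite unzip2_clinks rot_uniq.
elim: (clinks s) => //= -[d e] l IH /andP[dl ul].
rewrite !inE => /orP[/eqP e1|h1] /orP[/eqP e2|h2].
- by case: e1 e2 => -> _ [].
- by case/negP: dl; case: e1 => _ <-; apply/mapP; exists (b, c).
- by case/negP: dl; case: e2 => _ <-; apply/mapP; exists (a, c).
exact: IH.
Qed.

Lemma clinks_mem (s : seq T) a b : (a, b) \in clinks s -> (a \in s) /\ (b \in s).
Proof.
move=> h; split.
  by rewrite -(unzip1_clinks s); apply/mapP; exists (a, b).
by rewrite -(mem_rot 1) -(unzip2_clinks s); apply/mapP; exists (a, b).
Qed.

Lemma links_mem q u a b : (a, b) \in links (q :: u) -> b \in u.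
Proof.
move=> h; rewrite -(@unzip2_zip _ _ (q :: u) u); last by rewrite /=; lia.
by apply/mapP; exists (a, b).
Qed.

(** Putting [y] before [s] and [x] cyclically before [q] breaks only the two links that end in [s]
    and in [q]. *)
Lemma mem_clinks_insert q u s v x y a b : b != q -> b != s ->
  (a, b) \in clinks (q :: u ++ s :: v) ->
  (a, b) \in clinks (q :: u ++ y :: s :: v ++ [:: x]).
Proof.
move=> bq bs; rewrite clinks_cat.
rewrite clinks_cat (links_cat y [::] s) -[s :: v ++ _]cat_cons links_cat.
rewrite !(links_cat, mem_cat, inE) /= !xpair_eqE (negPf bq) (negPf bs) !andbF.
by rewrite !orFb orbF => /orP[->|->]; rewrite ?orbT.
Qed.

Lemma clinks_inserted q u s v x y :
  let w := q :: u ++ y :: s :: v ++ [:: x] in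
  [/\ (last q u, y) \in clinks w, (y, s) \in clinks w,
      (last s v, x) \in clinks w & (x, q) \in clinks w].
Proof.
rewrite /= clinks_cat (links_cat y [::] s) -[s :: v ++ _]cat_cons links_cat.
rewrite /= !last_cat /=.
by split; rewrite !(mem_cat, inE) eqxx ?orbT.
Qed.

Lemma uniq_heads q u r v w : uniq (q :: u ++ r :: v ++ w) ->
  [/\ q \notin u, r \notin u, q \notin v & r \notin v] /\
  (q \notin w /\ r \notin w).
Proof.
rewrite cons_uniq uniq_catC cat_cons cons_uniq => /andP[+ /andP[+ _]].
rewrite !(mem_cat, inE) !negb_or.
by case/and4P=> -> _ -> -> /andP[/andP[-> ->] ->].
Qed.

Lemma perm_insert2 (x y : T) u v w :
  perm_eq (u ++ x :: v ++ y :: w) (x :: y :: u ++ v ++ w).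
Proof.
apply/permP => p; rewrite /= !count_cat /= !count_cat /=; lia.
Qed.

End Links.
Arguments links : simpl never.
Arguments clinks : simpl never.

(** * Cycle decompositions and the insertion of a letter pair *)

Section Gluing.
Variable L : eqType.

(* The symbols inl k mark the places where the next letters will be inserted;  *)
(* being their own inverses they do not affect the vertex cycles.              *)
Local Notation sym := (nat + L * bool)%type.

Definition sinv (s : sym) : sym :=
  match s with inl k => inl k | inr l => inr (inv_letter l) end.

Lemma sinvK : involutive sinv.
Proof. by case=> [k|[l e]] //; rewrite /sinv /inv_letter /= negbK. Qed.

Definition is_letter (s : sym) : bool := if s is inr _ then true else false.

(* The corner before symbol s of w is represented by s, so that a vertex is a  *)
(* cycle of the map from s to the cyclic successor of (sinv s) in w.           *)
Definition traces (w c : seq sym) : bool :=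
  all (fun p => (sinv p.1, p.2) \in clinks w) (clinks c).

(** Demanding a letter in every cycle ensures that no cycle disappears when the markers are
    deleted. *)
Definition cycles_of (w : seq sym) (C : seq (seq sym)) : bool :=
  [&& uniq w, perm_eq (flatten C) w, all (has is_letter) C &
      all (traces w) C].

Lemma traces_eq w w' c : clinks w =i clinks w' -> traces w c = traces w' c.
Proof. by move=> e; apply: eq_all => p; rewrite e. Qed.

Lemma traces_catC w u v : traces w (u ++ v) = traces w (v ++ u).
Proof. exact/perm_all/perm_clinks_catC. Qed.

Lemma cycles_of_catC u v C : cycles_of (u ++ v) C -> cycles_of (v ++ u) C.
Proof.
case/and4P=> h1 h2 h3 h4; apply/and4P; split=> //.
- by rewrite uniq_catC.
- by rewrite (perm_trans h2) // perm_catC.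
apply: sub_all h4 => c; rewrite (@traces_eq _ (v ++ u)) //.
exact/perm_mem/perm_clinks_catC.
Qed.

Lemma cycles_of_perm w C C' : perm_eq C C' -> cycles_of w C -> cycles_of w C'.
Proof.
move=> e /and4P[h1 h2 h3 h4]; apply/and4P; split=> //.
- by rewrite -(permPl (perm_flatten e)).
- by rewrite -(perm_all _ e).
by rewrite -(perm_all _ e).
Qed.

Lemma cycles_of_rot w u v C :
  cycles_of w ((u ++ v) :: C) -> cycles_of w ((v ++ u) :: C).
Proof.
case/and4P=> h1 h2 /= /andP[h3 h4] /andP[h5 h6]; apply/and4P; split=> //=.
- by rewrite (perm_trans _ h2) //= perm_cat2r perm_catC.
- by rewrite has_cat orbC -has_cat h3.
by rewrite traces_catC h5.
Qed.

Lemma traces_insert (q s x y : sym) (u v c : seq sym) :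
    q \notin c -> s \notin c ->
  traces (q :: u ++ s :: v) c ->
  traces (q :: u ++ y :: s :: v ++ [:: x]) c.
Proof.
move=> qc sc /allP h; apply/allP => -[a b] abc.
have [_ bc] := clinks_mem abc.
apply: mem_clinks_insert; last exact: h abc.
  by apply: contraNneq qc => <-.
by apply: contraNneq sc => <-.
Qed.

Definition traces_inside (w c : seq sym) : bool :=
  all (fun p => (sinv p.1, p.2) \in clinks w) (links c).

Lemma traces_cons w q (A : seq sym) : traces w (q :: A) =
  traces_inside w (q :: A) && ((sinv (last q A), q) \in clinks w).
Proof. by rewrite /traces clinks_cons all_cat /= andbT. Qed.

Lemma traces_inside_cat w q r (A B : seq sym) :
  traces_inside w (q :: A ++ r :: B) =
  [&& traces_inside w (q :: A), (sinv (last q A), r) \in clinks w &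
      traces_inside w (r :: B)].
Proof. by rewrite /traces_inside links_cat all_cat. Qed.

Section Insert.
Variables (q s x y : sym) (u v : seq sym) (C : seq (seq sym)).
Hypotheses (xy : sinv x = y) (neq_xy : x != y).
Hypotheses (xl : is_letter x) (yl : is_letter y).
Hypotheses (xw : x \notin q :: u ++ s :: v) (yw : y \notin q :: u ++ s :: v).

Let w := q :: u ++ s :: v.
Let w' := q :: u ++ y :: s :: v ++ [:: x].

Let yx : sinv y = x. Proof. by rewrite -xy sinvK. Qed.

Let perm_w' : perm_eq w' (x :: y :: w).
Proof.
rewrite (perm_trans (perm_insert2 y x (q :: u) (s :: v) [::])) // cats0.
by rewrite (perm_catCA [:: y] [:: x]).
Qed.

Let uniq_w' : uniq w -> uniq w'.
Proof.
by move=> uw; rewrite (perm_uniq perm_w') !cons_uniq in_cons negb_or neq_xy xw yw.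
Qed.

Let traces_old c : q \notin c -> s \notin c -> traces w c -> traces w' c.
Proof. exact: traces_insert. Qed.

Let traces_links (A : seq sym) t : q \notin A -> s \notin A ->
  traces_inside w (t :: A) -> traces_inside w' (t :: A).
Proof.
move=> qA sA /allP h; apply/allP => -[a b] abA.
have bA := links_mem abA.
apply: mem_clinks_insert; last exact: h abA.
  by apply: contraNneq qA => <-.
by apply: contraNneq sA => <-.
Qed.

(** The arc [q :: A], which used to continue to [s], now meets [y]; the next symbol is the successor
    of [sinv y = x], which is [q], so the arc closes up. In the same way [s :: B] closes up through
    [x]. *)
Lemma insert_split A B :
    cycles_of w ((q :: A ++ s :: B) :: C) ->
  cycles_of w' ((q :: A ++ [:: y]) :: (s :: B ++ [:: x]) :: C).
Proof.
case/and4P=> uw pC /= /andP[_ hC] /andP[tAB tC].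
have [w1 w2 w3 w4] := clinks_inserted q u s v x y.
have uC : uniq (flatten ((q :: A ++ s :: B) :: C)) by rewrite (perm_uniq pC).
apply/and4P; split.
- exact: uniq_w'.
- rewrite perm_sym (perm_trans perm_w') // perm_sym.
  have -> : flatten ((q :: A ++ [:: y]) :: (s :: B ++ [:: x]) :: C) =
      (q :: A) ++ y :: (s :: B) ++ x :: flatten C.
    by rewrite /= -!catA /= -?catA.
  rewrite (perm_trans (perm_insert2 _ _ _ _ _)) //.
  rewrite (perm_trans (permEl (perm_catCA [:: y] [:: x] _))) //= perm_cons perm_cons.
  by move: pC; rewrite /= -catA.
- by rewrite /= hC !has_cat /= xl yl !orbT.
move: uC; rewrite /= -catA cat_cons => /uniq_heads[[qA sA qB sB] [qC sC]].
have tC' : all (traces w') C.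
  apply/allP => c cC; apply: traces_old (allP tC _ cC).
    by apply: contra qC => qc; apply/flattenP; exists c.
  by apply: contra sC => sc; apply/flattenP; exists c.
move: tAB; rewrite tC' andbT !traces_cons !traces_inside_cat last_cat /= -!andbA.
case/and4P=> tA hs tB hq.
have eA : sinv (last q A) = last q u.
  by apply: clinks_inj uw hs _; rewrite /w clinks_cat mem_cat inE eqxx orbT.
have eB : sinv (last s B) = last s v.
  apply: clinks_inj uw hq _.
  by rewrite /w clinks_cat !(mem_cat, inE) eqxx !orbT.
by rewrite !last_cat /= !traces_links // eA eB xy yx w1 w2 w3 w4.
Qed.

(** The cycle of [q] now runs into [x], and from there to the successor of [y], which is [s]; the
    cycle of [s] runs into [y] and from there back to [q]. *)
Lemma insert_merge A B :
    cycles_of w ((q :: A) :: (s :: B) :: C) ->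
  cycles_of w' ((q :: A ++ x :: s :: B ++ [:: y]) :: C).
Proof.
case/and4P=> uw pC /= /and3P[_ _ hC] /and3P[tA tB tC].
have [w1 w2 w3 w4] := clinks_inserted q u s v x y.
have uC : uniq (flatten ((q :: A) :: (s :: B) :: C)) by rewrite (perm_uniq pC).
apply/and4P; split.
- exact: uniq_w'.
- rewrite perm_sym (perm_trans perm_w') // perm_sym.
  have -> : flatten ((q :: A ++ x :: s :: B ++ [:: y]) :: C) =
      (q :: A) ++ x :: (s :: B) ++ y :: flatten C.
    by rewrite /= -!catA /= -?catA.
  by rewrite (perm_trans (perm_insert2 _ _ _ _ _)) // perm_cons perm_cons.
- by rewrite /= hC !has_cat /= xl !orbT.
move: uC; rewrite /= => /uniq_heads[[qA sA qB sB] [qC sC]].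
have tC' : all (traces w') C.
  apply/allP => c cC; apply: traces_old (allP tC _ cC).
    by apply: contra qC => qc; apply/flattenP; exists c.
  by apply: contra sC => sc; apply/flattenP; exists c.
move: tA tB; rewrite tC' andbT !traces_cons => /andP[tA hq] /andP[tB hs].
have eA : sinv (last q A) = last s v.
  apply: clinks_inj uw hq _.
  by rewrite /w clinks_cat !(mem_cat, inE) eqxx !orbT.
have eB : sinv (last s B) = last q u.
  by apply: clinks_inj uw hs _; rewrite /w clinks_cat mem_cat inE eqxx orbT.
rewrite traces_inside_cat (traces_inside_cat _ x s [::]).
rewrite traces_inside_cat last_cat /= last_cat /=.
by rewrite !traces_links // eA eB xy yx w1 w2 w3 w4.
Qed.

End Insert.

(* R_1 and R_3 grow at their left ends, just after inl 1 and inl 3, whereas    *)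
(* R_2 and R_4 grow at their right ends, just before inl 2 and inl 4.          *)
Definition cut_at k (V U : seq sym) : Prop :=
  if odd k then exists V', V = rcons V' (inl k)
  else exists U', U = inl k :: U'.

(** A marker is its own inverse, so a cycle and the word continue from it alike; the symbol behind
    the cut is therefore the same in both. *)
Lemma cut_at_head k w p V q U p1 A q1 B : uniq w ->
    (last p V, q) \in clinks w -> (sinv (last p1 A), q1) \in clinks w ->
    cut_at k (p :: V) (q :: U) -> cut_at k (p1 :: A) (q1 :: B) ->
  q1 = q.
Proof.
move=> uw h h1; rewrite /cut_at; case: odd; last first.
  by move=> [? [-> _]] [? [-> _]].
move=> [V' eV] [A' eA]; apply: clinks_fun uw h1 _; move: h.
have -> : last p V = inl k by rewrite -[LHS](last_cons p) eV last_rcons.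
by have -> : last p1 A = inl k by rewrite -[LHS](last_cons p1) eA last_rcons.
Qed.

Section InsertCut.
Variables (i j : nat) (x y : sym) (u v : seq sym) (C : seq (seq sym)).
Hypotheses (xy : sinv x = y) (neq_xy : x != y).
Hypotheses (xl : is_letter x) (yl : is_letter y).
Hypotheses (xw : x \notin u ++ v) (yw : y \notin u ++ v).
Hypotheses (u0 : u != [::]) (v0 : v != [::]).
Hypotheses (ci : cut_at i v u) (cj : cut_at j u v).

Lemma merge_cut c d : cut_at i c c -> cut_at j d d ->
    cycles_of (u ++ v) (c :: d :: C) ->
  cycles_of (u ++ y :: v ++ [:: x]) ((c ++ x :: d ++ [:: y]) :: C).
Proof.
case: u v u0 v0 ci cj xw yw => [|q u'] // [|s v'] // _ _ ci' cj' xw' yw'.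
case: c => [|q1 c] ic; first by move: ic; rewrite /cut_at; case: odd => -[[]].
case: d => [|s1 d] jd; first by move: jd; rewrite /cut_at; case: odd => -[[]].
move=> cyc; have /and4P[uw _ _ /= /and3P[tc td _]] := cyc.
move: tc td; rewrite !traces_cons => /andP[_ tc] /andP[_ td].
have eq : q1 = q.
  apply: cut_at_head uw _ tc ci' ic.
  by rewrite clinks_cat !(mem_cat, inE) eqxx !orbT.
have es : s1 = s.
  apply: cut_at_head uw _ td cj' jd.
  by rewrite clinks_cat !(mem_cat, inE) eqxx !orbT.
by subst q1 s1; exact: insert_merge.
Qed.

Lemma split_cut c d : cut_at i (c ++ d) (c ++ d) -> cut_at j c d ->
    cycles_of (u ++ v) ((c ++ d) :: C) ->
  cycles_of (u ++ y :: v ++ [:: x]) ((c ++ [:: y]) :: (d ++ [:: x]) :: C).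
Proof.
case: u v u0 v0 ci cj xw yw => [|q u'] // [|s v'] // _ _ ci' cj' xw' yw'.
move=> icd jcd cyc; have /and4P[uw _ _ /= /andP[tcd _]] := cyc.
(* The two cuts lie before different symbols; this excludes the cases of an empty [c] or [d]. *)
have qs : q != s.
  by move: uw; rewrite /= mem_cat inE !negb_or => /andP[/and3P[]].
have lu : (last q u', s) \in clinks (q :: u' ++ s :: v').
  by rewrite clinks_cat !(mem_cat, inE) eqxx !orbT.
have lv : (last s v', q) \in clinks (q :: u' ++ s :: v').
  by rewrite clinks_cat !(mem_cat, inE) eqxx !orbT.
have head q1 e : c ++ d = q1 :: e -> q1 = q.
  move=> e1; move: icd tcd; rewrite e1 traces_cons => icd /andP[_ td].
  exact: cut_at_head uw lv td ci' icd.
case: c => [|q1 c] in icd jcd tcd cyc head *.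
  move: jcd cj'; rewrite /cut_at; case: odd => -[]; first by case.
  move=> d' ed [v'' [es _]]; case/eqP: qs.
  by rewrite es (head _ _ ed).
have eq : q1 = q by apply: head.
subst q1; case: d => [|s1 d] in icd jcd tcd cyc head *.
  move: jcd cj'; rewrite /cut_at; case: odd => -[] c' // ec [u'' eu].
  case/eqP: qs; move: tcd; rewrite cats0 traces_cons => /andP[_ tq].
  apply: clinks_fun uw tq _.
  suff -> : sinv (last q c) = last q u' by [].
  rewrite -[last q u'](last_cons q) eu last_rcons.
  by rewrite -[last q c](last_cons q) ec last_rcons.
have es : s1 = s.
  move: tcd; rewrite traces_cons traces_inside_cat => /andP[/and3P[_ tj _] _].
  exact: cut_at_head uw lu tj cj' jcd.
by subst s1; exact: insert_split.
Qed.

End InsertCut.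

(** * Reduction of the cycles to their markers *)

Definition proj (c : seq sym) : seq nat :=
  pmap (fun s : sym => if s is inl k then Some k else None) c.

Lemma proj_cat c d : proj (c ++ d) = proj c ++ proj d.
Proof. exact: pmap_cat. Qed.

Lemma proj_letter s c : is_letter s -> proj (s :: c) = proj c.
Proof. by case: s. Qed.

Lemma proj_split c k P Q : proj c = P ++ k :: Q ->
  exists c1 c2, [/\ c = c1 ++ inl k :: c2, proj c1 = P & proj c2 = Q].
Proof.
elim: c P => [|[l|x] c IH] P /=; first by case: P.
- case: P => [[-> <-]|p P [-> /IH[c1 [c2 [-> <- <-]]]]]; first by exists [::], c.
  by exists (inl p :: c1), c2.
by move=> /IH[c1 [c2 [-> <- <-]]]; exists (inr x :: c1), c2.
Qed.

Lemma cycles_of_proj_rot w c C n : cycles_of w (c :: C) ->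
  exists2 d, cycles_of w (d :: C) & proj d = rot n (proj c).
Proof.
rewrite /rot; case e : (drop n (proj c)) => [|k Q].
  by exists c => //; move: (cat_take_drop n (proj c)); rewrite e cats0.
move: (cat_take_drop n (proj c)); rewrite e => /esym /proj_split.
case=> c1 [c2 [-> e1 e2]] /cycles_of_rot h.
by exists ((inl k :: c2) ++ c1) => //; rewrite proj_cat /= e2 e1.
Qed.

(** The trace of [cut_at] on marker sequences, in decidable form. *)
Definition pcut k (V U : seq nat) : bool :=
  if odd k then (V != [::]) && (last 0 V == k)
  else (U != [::]) && (head 0 U == k).

Lemma cycles_of_cut w c C k : pcut k (proj c) (proj c) ->
    cycles_of w (c :: C) ->
  exists d, [/\ cycles_of w (d :: C), proj d = proj c & cut_at k d d].
Proof.
rewrite /pcut /cut_at; case: odd.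
  case/lastP e : (proj c) => [|P l] //; rewrite last_rcons => /andP[_ /eqP e1].
  move: e; rewrite e1 -cats1 => e.
  have [c1 [c2 [-> e3 e2]]] := proj_split e.
  rewrite -cat_rcons => /cycles_of_rot h; exists (c2 ++ rcons c1 (inl k)).
  split; first exact: h.
    by rewrite !proj_cat /= e2 -cats1 proj_cat e3.
  by exists (c2 ++ c1); rewrite rcons_cat.
case e : (proj c) => [|l P] //= /eqP e1; move: e; rewrite e1 => e.
have [c1 [c2 [-> e3 e2]]] := @proj_split c k [::] P e.
move=> /cycles_of_rot h; exists ((inl k :: c2) ++ c1).
split; first exact: h.
  by rewrite !proj_cat /= e2 e3 cats0.
by exists (c2 ++ c1).
Qed.

Lemma proj_cut c k A B : pcut k A B -> proj c = A ++ B ->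
  exists c1 c2, [/\ c = c1 ++ c2, proj c1 = A, proj c2 = B & cut_at k c1 c2].
Proof.
rewrite /pcut /cut_at; case: odd.
  case/lastP: A => [|P l] //; rewrite last_rcons => /andP[_ /eqP e1].
  rewrite e1 cat_rcons => /proj_split[c1 [c2 [-> e3 e2]]].
  exists (rcons c1 (inl k)), c2; rewrite cat_rcons.
  by split=> //; [rewrite -!cats1 proj_cat e3 | exists c1].
case: B => [|l P] //= /eqP -> /proj_split[c1 [c2 [-> e3 e2]]].
by exists c1, (inl k :: c2); split=> //=; [rewrite e2 | exists c2].
Qed.

(* A canonical rotation; 5 exceeds all place markers. *)
Definition canon (c : seq nat) := rot (index (foldr minn 5 c) c) c.
Definition canons (Q : seq (seq nat)) := [seq canon c | c <- Q & c != [::]].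

(** The state [Q] is taken up to rotation and order and ignores vertices without markers, whereas
    [m] counts all vertices. *)
Definition realizes w (Q : seq (seq nat)) m : Prop :=
  exists C, [/\ cycles_of w C, size C = m & perm_eq (canons (map proj C)) (canons Q)].

Lemma realizes_catC u v Q m : realizes (u ++ v) Q m -> realizes (v ++ u) Q m.
Proof. by case=> C [/cycles_of_catC h1 h2 h3]; exists C. Qed.

Lemma realizes_canons w Q Q' m : perm_eq (canons Q) (canons Q') ->
  realizes w Q m -> realizes w Q' m.
Proof. by move=> e [C [h1 h2 h3]]; exists C; split=> //; exact: perm_trans e. Qed.

(** [D] holds cycles that are already singled out, so that two cycles can be extracted in succession
    before a merge. *)
Lemma extract_cycle w D C A Q : A != [::] ->
    cycles_of w (D ++ C) -> perm_eq (canons (map proj C)) (canons (A :: Q)) ->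
  exists c C', [/\ cycles_of w (c :: D ++ C'), size C = (size C').+1,
    proj c = A & perm_eq (canons (map proj C')) (canons Q)].
Proof.
rewrite /canons /= => A0 cyc; rewrite A0 /= => pC.
have : canon A \in [seq canon c | c <- [seq proj i | i <- C] & c != [::]].
  by rewrite (perm_mem pC) inE eqxx.
case/mapP => P; rewrite mem_filter => /andP[P0 /mapP[c cC eP]] eAP.
have eC := perm_to_rem cC.
have pD : perm_eq (D ++ C) (c :: D ++ rem c C).
  rewrite -cat1s perm_sym (perm_trans (permEl (perm_catCA [:: c] D _))) //.
  by rewrite perm_cat2l perm_sym.
(* The first rotation reaches the canonical form shared by [P] and [A]; the second undoes the
   canonical rotation of [A]. *)
have [d cycd pd] := cycles_of_proj_rot
  (index (foldr minn 5 P) P) (cycles_of_perm pD cyc).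
have [d' cycd' pd'] := cycles_of_proj_rot
  (size (canon A) - index (foldr minn 5 A) A) cycd.
exists d', (rem c C); split => //.
- by rewrite (perm_size eC).
- by rewrite pd' pd -eP -/(canon P) -eAP -[RHS](rotK (index (foldr minn 5 A) A)).
have := perm_map canon (perm_filter (fun c => c != [::]) (perm_map proj eC)).
rewrite /= -eP P0 /= => h; rewrite -(perm_cons (canon A)).
by rewrite perm_sym {2}eAP (perm_trans _ h) // perm_sym.
Qed.

Section RealizesInsert.
Variables (i j : nat) (x y : sym) (u v : seq sym) (Q : seq (seq nat)).
Hypotheses (xy : sinv x = y) (neq_xy : x != y).
Hypotheses (xl : is_letter x) (yl : is_letter y).
Hypotheses (xw : x \notin u ++ v) (yw : y \notin u ++ v).
Hypotheses (u0 : u != [::]) (v0 : v != [::]).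
Hypotheses (ci : cut_at i v u) (cj : cut_at j u v).

Lemma pcut_neq0 k A B : pcut k A B -> A ++ B != [::].
Proof.
by rewrite /pcut; case: odd => /andP[]; case: A => //= a A; case: B.
Qed.

Lemma realizes_merge A B m : pcut i A A -> pcut j B B ->
    realizes (u ++ v) (A :: B :: Q) m ->
  exists2 m', m = m'.+1 & realizes (u ++ y :: v ++ [:: x]) ((A ++ B) :: Q) m'.
Proof.
move=> iA jB [C [cyc <- pC]].
have A0 : A != [::] by move: iA; rewrite /pcut; case: odd => /andP[].
have B0 : B != [::] by move: jB; rewrite /pcut; case: odd => /andP[].
have [c1 [C1 [cyc1 -> e1 pC1]]] := @extract_cycle _ [::] _ _ _ A0 cyc pC.
have [c2 [C2 [cyc2 -> e2 pC2]]] := @extract_cycle _ [:: c1] _ _ _ B0 cyc1 pC1.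
exists (size C2).+1 => //.
subst A B; have [d2 [cyc3 e3 cd2]] := cycles_of_cut jB cyc2.
have /= := cycles_of_perm (permEl (perm_catCA [:: d2] [:: c1] C2)) cyc3.
case/(cycles_of_cut iA) => d1 [cyc4 e4 cd1].
have cyc5 := merge_cut xy neq_xy xl xw yw u0 v0 ci cj cd1 cd2 cyc4.
eexists; split; [exact: cyc5 | by [] |].
rewrite /canons /= proj_cat (proj_letter _ xl) proj_cat (proj_letter _ yl) /=.
rewrite cats0 e3 e4.
by case: (_ ++ _) => //= *; rewrite perm_cons.
Qed.

Lemma realizes_split A B m : pcut i (A ++ B) (A ++ B) -> pcut j A B ->
    realizes (u ++ v) ((A ++ B) :: Q) m ->
  realizes (u ++ y :: v ++ [:: x]) (A :: B :: Q) m.+1.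
Proof.
move=> iA jB [C [cyc <- pC]].
have A0 := pcut_neq0 jB.
have [c1 [C1 [cyc1 -> e1 pC1]]] := @extract_cycle _ [::] _ _ _ A0 cyc pC.
rewrite -e1 in iA; have [d1 [cyc2 e2 cd1]] := cycles_of_cut iA cyc1.
rewrite e1 in e2; have [c [d [ecd ec ed jcd]]] := proj_cut jB e2.
subst d1.
have cyc5 := split_cut xy neq_xy xl yl xw yw u0 v0 ci cj cd1 jcd cyc2.
eexists; split; [exact: cyc5 | by [] |].
rewrite /canons /= !proj_cat (proj_letter _ xl) (proj_letter _ yl) /= !cats0.
rewrite ec ed.
by case: (A != [::]); case: (B != [::]); rewrite /= ?perm_cons.
Qed.

End RealizesInsert.

End Gluing.

(** * Vertices of the polygon as cycles *)

Section Vertices.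
Variable L : eqType.
Local Notation sym := (nat + L * bool)%type.

Lemma clinks_behead (T : eqType) (k r s t : T) u : s != k -> t != k ->
  (s, t) \in clinks (k :: r :: u) -> (s, t) \in clinks (r :: u).
Proof.
move=> sk tk; rewrite clinks_cons (links_cat k [::] r u) clinks_cons.
rewrite !(mem_cat, inE) !xpair_eqE (negPf sk) (negPf tk) andbF orbF /=.
by move=> ->.
Qed.

(** The self-inverse marker has the same successor in the word and in its cycle, so removing it
    joins its neighbours consistently in both. *)
Lemma cycles_of_behead k (w c : seq sym) C :
    cycles_of (inl k :: w) ((inl k :: c) :: C) -> cycles_of w (c :: C).
Proof.
case/and4P=> /= /andP[kw uw] pC /andP[hc hC] /andP[tc tC].
move: pC; rewrite perm_cons => pC.
have kC : inl k \notin flatten (c :: C) by rewrite (perm_mem pC).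
case: c => [|q c] // in hc pC tc kC *.
case: w => [|r u] in pC kw uw tc tC *; first by move/perm_size: pC.
have uw' : uniq (inl k :: r :: u) by rewrite /= kw.
have eq_qr : q = r.
  have h : (inl k, r) \in clinks (inl k :: r :: u).
    by rewrite clinks_cons (links_cat _ [::]) !inE eqxx.
  move: tc; rewrite traces_cons (traces_inside_cat _ _ _ [::]).
  by case/andP=> /and3P[_ h1 _] _; exact: clinks_fun uw' h1 h.
subst r.
have eA : sinv (last q c) = last q u.
  move: tc; rewrite traces_cons => /andP[_ h]; apply: clinks_inj uw' h _.
  by rewrite clinks_cons mem_cat [X in _ || X]inE eqxx orbT.
have sk (s : sym) : s != inl k -> sinv s != inl k by case: s.
apply/and4P; split=> //; first exact/andP.
rewrite /=.
apply/andP; split.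
  rewrite traces_cons eA; apply/andP; split; last first.
    by rewrite clinks_cons mem_cat inE eqxx orbT.
  move: tc; rewrite traces_cons (traces_inside_cat _ _ _ [::]).
  case/andP=> /and3P[_ _ /allP h] _; apply/allP=> -[a b] ab.
  have abc : (a, b) \in clinks (q :: c) by rewrite clinks_cons mem_cat ab.
  have [ac bc] := clinks_mem abc.
  have in_kC z : z \in q :: c -> z != inl k.
    by move=> zc; apply: contraNneq kC => <-; rewrite mem_cat zc.
  by apply: clinks_behead (h _ ab); [apply/sk/in_kC | apply: in_kC].
apply/allP=> d dC; have /allP h := allP tC d dC; apply/allP=> -[a b] ab.
have [ac bc] := clinks_mem ab.
have in_kC z : z \in d -> z != inl k.
  move=> zc; apply: contraNneq kC => <-.
  by rewrite mem_cat; apply/orP; right; apply/flattenP; exists d.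
by apply: clinks_behead (h _ ab); [apply/sk/in_kC | apply: in_kC].
Qed.

(** Rotations bring the marker to the front of the word and of its cycle, where [cycles_of_behead]
    applies. *)
Lemma cycles_of_del k (w : seq sym) C : cycles_of w C ->
  cycles_of (filter (predC1 (inl k)) w) (map (filter (predC1 (inl k))) C).
Proof.
set P := predC1 _.
have idP (s : seq sym) : inl k \notin s -> filter P s = s.
  by move=> ks; apply/all_filterP/allP => z zs; apply: contraNneq ks => <-.
have PS d : inl k \in d -> uniq d ->
    exists d1 d2, [/\ d = d1 ++ inl k :: d2, filter P d = d1 ++ d2 &
      inl k \notin d2 ++ d1].
  move/splitPr=> [d1 d2]; rewrite uniq_catC cat_cons /= => /andP[h _].
  exists d1, d2; split=> //; rewrite filter_cat /= eqxx /=.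
  by move: h; rewrite mem_cat negb_or => /andP[h1 h2]; rewrite !idP.
move=> cyc; have /and4P[uw pC _ _] := cyc.
case: (boolP (inl k \in w)) => [kw|kw]; last first.
  rewrite idP // -[X in cycles_of _ X]/(map _ C).
  rewrite (_ : map _ C = C) //; rewrite -[RHS]map_id; apply/eq_in_map => c cC.
  rewrite idP //; apply: contra kw => kc; rewrite -(perm_mem pC).
  by apply/flattenP; exists c.
have : inl k \in flatten C by rewrite (perm_mem pC).
case/flattenP => c cC kc.
have pcC := perm_to_rem cC.
apply: (@cycles_of_perm _ _ (map (filter P) (c :: rem c C))).
  by rewrite perm_sym perm_map.
have {}cyc := cycles_of_perm pcC cyc.
have uC : uniq (flatten (c :: rem c C)).
  by rewrite (perm_uniq (_ : perm_eq _ w)) //; case/and4P: cyc.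
have uc : uniq c by move: uC; rewrite /= cat_uniq => /andP[].
have [w1 [w2 [ew -> kw']]] := PS _ kw uw.
have [c1 [c2 [ec /= -> kc']]] := PS _ kc uc.
move: cyc; rewrite {1}ec {1}ew => /cycles_of_rot /cycles_of_catC /= cyc.
move/cycles_of_behead: cyc => cyc.
rewrite (_ : [seq filter P i | i <- rem c C] = rem c C).
  by move: cyc => /cycles_of_catC/cycles_of_rot.
rewrite -[RHS]map_id; apply/eq_in_map => d dC.
rewrite idP //; apply/negP => kd; move: uC; rewrite /= cat_uniq.
case/and3P=> _ /negP h _; apply: h; apply/hasP; exists (inl k) => //.
by apply/flattenP; exists d.
Qed.

Lemma find_flatten (T : eqType) (C : seq (seq T)) k a :
    uniq (flatten C) -> k < size C -> a \in nth [::] C k ->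
  find (fun c => a \in c) C = k.
Proof.
elim: C k => //= c C IH [|k]; first by move=> _ _ /= ->.
rewrite cat_uniq => /and3P[_ /hasPn ac uC] /= kC ak.
have aC : a \in flatten C.
  by apply/flattenP; exists (nth [::] C k) => //; apply: mem_nth.
by rewrite (negPf (ac _ aC)) (IH k).
Qed.

Lemma cycle_clinks (T : eqType) (e : rel T) c :
  cycle e c = all (fun p => e p.1 p.2) (clinks c).
Proof.
have path_links a v : path e a v = all (fun p => e p.1 p.2) (links (a :: v)).
  by elim: v a => //= b v IH a; rewrite IH.
by case: c => //= q u; rewrite path_links.
Qed.

Lemma clinks_map (T U : eqType) (g : T -> U) c :
  clinks (map g c) = [seq (g p.1, g p.2) | p <- clinks c].
Proof.
rewrite !clinks_zip -map_rot; elim: c (rot 1 c) => [|a c IH] [|b d] //=.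
by rewrite IH.
Qed.

Lemma mem_clinks_ordS (w : seq (L * bool)) (i : 'I_(size w)) :
  (inr (tnth (in_tuple w) i) : sym, inr (tnth (in_tuple w) (ordS i)) : sym)
    \in clinks (map inr w).
Proof.
rewrite clinks_map; apply/mapP.
exists (tnth (in_tuple w) i, tnth (in_tuple w) (ordS i)) => //.
case: w i => [[]//|q u] i; rewrite clinks_zip !(tnth_nth q).
apply/(nthP (q, q)); exists i; first by rewrite size_zip size_rot minnn.
rewrite nth_zip ?size_rot //; congr (_, _).
rewrite rot1_cons nth_rcons /=.
have := ltn_ord i; rewrite ltnS leq_eqVlt => /orP[/eqP e|h].
  by rewrite e ltnn eqxx modnn.
by rewrite h modn_small.
Qed.

Section Count.
Variables (w : seq (L * bool)) (C : seq (seq sym)).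
Hypothesis cyc : cycles_of (map inr w) C.

Let n := size w.
Let e := @glued_corners L w.
Let t (i : 'I_n) : sym := inr (tnth (in_tuple w) i).
Let f (i : 'I_n) := find (fun c => t i \in c) C.

Let uw : uniq (map inr w : seq sym). Proof. by case/and4P: cyc. Qed.

Let uC : uniq (flatten C).
Proof. by case/and4P: cyc => _ pC _ _; rewrite (perm_uniq pC). Qed.

Let t_inj : injective t.
Proof.
have uw0 : uniq w by move: uw; rewrite map_inj_uniq // => a b [].
move=> i j [h]; apply/val_inj/eqP; set x0 := tnth (in_tuple w) i.
have tE k : tnth (in_tuple w) k = nth x0 w k by rewrite (tnth_nth x0).
by rewrite -(nth_uniq x0 (ltn_ord i) (ltn_ord j) uw0) -!tE h.
Qed.

Let t_mem i : has (fun c => t i \in c) C.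
Proof.
have : t i \in flatten C.
  case/and4P: cyc => _ pC _ _; rewrite (perm_mem pC).
  exact/map_f/mem_tnth.
by case/flattenP=> c cC tc; apply/hasP; exists c.
Qed.

Let f_lt i : f i < size C. Proof. by rewrite -has_find. Qed.

Let f_mem i : t i \in nth [::] C (f i). Proof. exact: nth_find (t_mem i). Qed.

Let tracesC k : k < size C -> traces (map inr w) (nth [::] C k).
Proof. by case/and4P: cyc => _ _ _ /allP h kC; apply/h/mem_nth. Qed.

Let glued_t i j : glued_sides i j = (t j == sinv (t i)).
Proof. by []. Qed.

Let f_glued i j : t j = sinv (t i) -> f (ordS j) = f i.
Proof.
move=> ji; have ti := f_mem i.
have : t i \in unzip1 (clinks (nth [::] C (f i))) by rewrite unzip1_clinks.
case/mapP=> -[a b] abc /= ea; subst a.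
have h := allP (tracesC (f_lt i)) _ abc.
have eb : t (ordS j) = b.
  apply: clinks_fun uw _ h; have := mem_clinks_ordS j.
  by rewrite -/(t j) ji.
apply: find_flatten => //; rewrite eb.
by have [] := clinks_mem abc.
Qed.

Let glued_sym i j : t j = sinv (t i) -> t i = sinv (t j).
Proof. by move=> ->; rewrite sinvK. Qed.

Let e_f i j : e i j -> f i = f j.
Proof.
case/existsP=> i' /existsP[j'] /andP[]; rewrite glued_t => /eqP ij.
case/orP=> /andP[/eqP-> /eqP->]; first by rewrite (f_glued ij).
by rewrite (f_glued (glued_sym ij)).
Qed.

Let e_sym : connect_sym e.
Proof.
apply: sym_connect_sym => i j.
have aux a b : e a b -> e b a.
  case/existsP=> i' /existsP[j'] /andP[]; rewrite glued_t => /eqP ij h.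
  apply/existsP; exists j'; apply/existsP; exists i'; rewrite glued_t.
  rewrite {1}(glued_sym ij) eqxx /= orbC andbC [X in _ || X]andbC.
  exact: h.
by apply/idP/idP; apply: aux.
Qed.

Let f_connect i j : connect e i j -> f i = f j.
Proof.
move=> h; have cl : closed e [pred z | f z == f i].
  by move=> a b /e_f; rewrite !inE => ->.
by have := closed_connect cl h; rewrite !inE eqxx => /esym/eqP.
Qed.

(** Consecutive symbols of a traced cycle are glued corners, so the cycle becomes a cycle of the
    relation [e] and all its corners are connected. *)
Let connect_f i j : f i = f j -> connect e i j.
Proof.
move=> fij; set c := nth [::] C (f i).
pose g (a : sym) : 'I_n := insubd i (index a (map inr w : seq sym)).
have tg a : a \in (map inr w : seq sym) -> t (g a) = a.
  move=> aw; rewrite /t (tnth_nth (tnth (in_tuple w) i)) /=.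
  rewrite val_insubd; have ia : index a (map inr w : seq sym) < n.
    by move: aw; rewrite -index_mem size_map.
  rewrite ia -[RHS](nth_index (t i) aw).
  by rewrite (nth_map (tnth (in_tuple w) i)).
have gt k : g (t k) = k by exact/t_inj/tg/map_f/mem_tnth.
have cycle_c : cycle e (map g c).
  rewrite cycle_clinks clinks_map all_map; apply/allP=> -[a b] ab /=.
  have h := allP (tracesC (f_lt i)) _ ab.
  have [aw bw] := clinks_mem h.
  have acw : a \in (map inr w : seq sym).
    have [ac _] := clinks_mem ab; case/and4P: cyc => _ pC _ _.
    rewrite -(perm_mem pC); apply/flattenP; exists c => //.
    exact: mem_nth.
  apply/existsP; exists (g a); apply/existsP; exists (g (sinv a)).
  rewrite glued_t !tg // eqxx /= eqxx /=; apply/orP; left; apply/eqP/t_inj.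
  rewrite tg //; apply: clinks_fun uw h _.
  by have := mem_clinks_ordS (g (sinv a)); rewrite -/(t (g _)) tg.
apply: (connect_cycle cycle_c).
  by apply/mapP; exists (t i); rewrite ?gt //; apply: f_mem.
by apply/mapP; exists (t j); rewrite ?gt // /c fij; apply: f_mem.
Qed.

(** The index of the cycle through a corner gives a bijection from component roots to cycles; it is
    onto because every cycle contains a letter. *)
Lemma num_vertices_cycles : num_vertices w = size C.
Proof.
rewrite /num_vertices /n_comp_mem -/e -[RHS]card_ord.
pose F (i : 'I_n) := Ordinal (f_lt i).
have injF : {in predI (roots e) (mem predT) &, injective F}.
  move=> i j /andP[/eqP ri _] /andP[/eqP rj _] [/connect_f].
  by rewrite -(root_connect e_sym) ri rj => /eqP.
rewrite -(card_in_image injF); apply: eq_card => k; rewrite [RHS]inE.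
case/and4P: cyc => _ pC /all_nthP hC _.
have /hasP[[//|l] lk _] := hC [::] k (ltn_ord k).
have : inr l \in (map inr w : seq sym).
  rewrite -(perm_mem pC); apply/flattenP.
  by exists (nth [::] C k) => //; apply: mem_nth.
case/mapP=> l' /(tnthP (in_tuple w))[i ->] [el].
apply/imageP; exists (fingraph.root e i); first by rewrite inE /= (roots_root e_sym).
apply/val_inj => /=; rewrite -(f_connect (connect_root e i)).
by apply/esym/find_flatten; rewrite // /t -el.
Qed.
End Count.

End Vertices.

(** * The automaton of letter insertions *)

(** Puts slot [k] at the seam of the cycle: an odd marker comes last, an even one first. *)
Definition align k (c : seq nat) := rot (index k c + odd k) c.

(* The boolean tells whether two vertices are merged. *)
Definition step (Q : seq (seq nat)) (i j : nat) : bool * seq (seq nat) :=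
  let ci := align i (nth [::] Q (find (fun c => i \in c) Q)) in
  let cj := align j (nth [::] Q (find (fun c => j \in c) Q)) in
  let rest := [seq c <- Q | (i \notin c) && (j \notin c)] in
  if j \in ci then
    let t := index j ci + odd j in (false, [:: take t ci, drop t ci & rest])
  else (true, (ci ++ cj) :: rest).

(** The hypotheses of [realizes_split] or [realizes_merge], as a test that can be run on each
    state. *)
Definition step_ok (Q : seq (seq nat)) (i j : nat) : bool :=
  let ci := align i (nth [::] Q (find (fun c => i \in c) Q)) in
  let cj := align j (nth [::] Q (find (fun c => j \in c) Q)) in
  let rest := [seq c <- Q | (i \notin c) && (j \notin c)] in
  let t := index j ci + odd j in
  if j \in ci then
    [&& perm_eq (canons Q) (canons (ci :: rest)), pcut i ci ci &
        pcut j (take t ci) (drop t ci)]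
  else
    [&& perm_eq (canons Q) (canons [:: ci, cj & rest]), pcut i ci ci &
        pcut j cj cj].

Definition normal (Q : seq (seq nat)) : seq (seq nat) :=
  sort (fun c d => head 0 c <= head 0 d) (canons Q).

(* The places of a_k and of a_k^- when c = (k \in K, k \in T).                  *)
Definition slot1 (c : bool * bool) := if c.1 then 1 else 2.
Definition slot2 (c : bool * bool) := if c.2 then 3 else 4.

Definition trans (Q : seq (seq nat)) (c : bool * bool) : bool * seq (seq nat) :=
  let r := step Q (slot1 c) (slot2 c) in (r.1, normal r.2).

(** The three vertices of the sphere [a a^- b b^-], seen from the markers. *)
Definition start : seq (seq nat) := [:: [:: 1; 3]; [:: 2]; [:: 4]].

(* All states reachable from start. *)
Definition states : seq (seq (seq nat)) :=
  [:: [:: [:: 1; 3]; [:: 2]; [:: 4]];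
      [:: [:: 1]; [:: 2]; [:: 3]; [:: 4]];
      [:: [:: 1; 4; 3]; [:: 2]];
      [:: [:: 1; 3; 2]; [:: 4]];
      [:: [:: 1; 3]; [:: 2; 4]];
      [:: [:: 1; 4]; [:: 2]; [:: 3]];
      [:: [:: 1]; [:: 2; 3]; [:: 4]];
      [:: [:: 1]; [:: 2; 4]; [:: 3]];
      [:: [:: 1]; [:: 2]; [:: 3; 4]];
      [:: [:: 1; 4; 3; 2]];
      [:: [:: 1; 2; 4; 3]];
      [:: [:: 1; 2]; [:: 3]; [:: 4]];
      [:: [:: 1; 3; 4; 2]];
      [:: [:: 1; 4; 2; 3]];
      [:: [:: 1; 3; 2; 4]];
      [:: [:: 1; 3; 4]; [:: 2]];
      [:: [:: 1; 4]; [:: 2; 3]];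
      [:: [:: 1; 2; 4]; [:: 3]];
      [:: [:: 1; 2; 3]; [:: 4]];
      [:: [:: 1]; [:: 2; 3; 4]];
      [:: [:: 1; 4; 2]; [:: 3]];
      [:: [:: 1]; [:: 2; 4; 3]];
      [:: [:: 1; 2]; [:: 3; 4]];
      [:: [:: 1; 2; 3; 4]]].

Definition choices := [:: (true, true); (true, false); (false, true); (false, false)].

Definition trans_ok Q c :=
  [&& step_ok Q (slot1 c) (slot2 c),
      perm_eq (canons (step Q (slot1 c) (slot2 c)).2) (canons (trans Q c).2) &
      (trans Q c).2 \in states].

Lemma trans_okP Q c : Q \in states -> trans_ok Q c.
Proof.
have h : all (fun Q => all (trans_ok Q) choices) states by vm_compute.
move=> Ss; apply: (allP (allP h Q Ss)).
by case: c => -[] [].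
Qed.

(** * Ladder words as runs of the automaton *)

Section Step.
Variable L : eqType.
Local Notation sym := (nat + L * bool)%type.

(** A split turns [m] vertices into [m + 1] and a merge into [m - 1]; the equation covers both
    without subtraction. *)
Lemma realizes_step i j (x y : sym) u v Q m :
    sinv x = y -> x != y -> is_letter x -> is_letter y ->
    x \notin u ++ v -> y \notin u ++ v -> u != [::] -> v != [::] ->
    cut_at i v u -> cut_at j u v -> step_ok Q i j ->
    realizes (u ++ v) Q m ->
  exists2 m', m' + (step Q i j).1.*2 = m.+1 &
    realizes (u ++ y :: v ++ [:: x]) (step Q i j).2 m'.
Proof.
move=> xy nxy xl yl xw yw u0 v0 ci cj; rewrite /step_ok /step.
case: ifP => _ /and3P[pS iS jS] /(realizes_canons pS) rS.
  exists m.+1; first by rewrite addn0.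
  apply: (realizes_split xy nxy xl yl xw yw u0 v0 ci cj _ jS).
    by rewrite cat_take_drop.
  by rewrite cat_take_drop.
have [m' -> r'] := realizes_merge xy nxy xl yl xw yw u0 v0 ci cj iS jS rS.
by exists m' => //=; rewrite !addnS addn0.
Qed.

Variables a b : L.

Definition frame (W1 W2 W3 W4 : seq sym) : seq sym :=
  inl 1 :: W1 ++ inl 3 :: W3 ++ inr (a, false) :: W2 ++
  [:: inl 2, inr (a, true), inr (b, false) & W4 ++ [:: inl 4; inr (b, true)]].

Local Ltac cat_nf := rewrite /= -?catA /= -?catA /= -?catA /= -?catA /=.

Lemma frame_step (W1 W2 W3 W4 : seq sym) l c Q m :
    let x : sym := inr (l, false) in let y : sym := inr (l, true) in
    x \notin frame W1 W2 W3 W4 -> y \notin frame W1 W2 W3 W4 ->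
    Q \in states -> realizes (frame W1 W2 W3 W4) Q m ->
  exists2 m', m' + (trans Q c).1.*2 = m.+1 &
    realizes (frame (if c.1 then x :: W1 else W1)
      (if c.1 then W2 else rcons W2 x) (if c.2 then y :: W3 else W3)
      (if c.2 then W4 else rcons W4 y)) (trans Q c).2 m'.
Proof.
move=> x y xw yw Qs rQ; have /and3P[okQ eQ _] := trans_okP c Qs.
suff [m' em' r'] : exists2 m', m' + (trans Q c).1.*2 = m.+1 &
    realizes (frame (if c.1 then x :: W1 else W1)
      (if c.1 then W2 else rcons W2 x) (if c.2 then y :: W3 else W3)
      (if c.2 then W4 else rcons W4 y)) (step Q (slot1 c) (slot2 c)).2 m'.
  by exists m' => //; apply: realizes_canons r'.
(* The word is rotated until the place of [x] is at the seam and the place of [y] separates [u] from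
   [v]; after the insertion it is rotated back. *)
have main u v s t s' t' : frame W1 W2 W3 W4 = s ++ t -> t ++ s = u ++ v ->
    u ++ y :: v ++ [:: x] = t' ++ s' -> u != [::] -> v != [::] ->
    cut_at (slot1 c) v u -> cut_at (slot2 c) u v ->
  exists2 m', m' + (trans Q c).1.*2 = m.+1 &
    realizes (s' ++ t') (step Q (slot1 c) (slot2 c)).2 m'.
  move=> es et e' u0 v0 cu cv.
  have pw : perm_eq (u ++ v) (frame W1 W2 W3 W4) by rewrite -et es perm_catC.
  have r : realizes (u ++ v) Q m by rewrite -et; apply/realizes_catC; rewrite -es.
  have nxy : x != y by apply/eqP => -[].
  have [//|//|||m' em' r'] :=
    realizes_step (erefl y : sinv x = y) nxy _ _ _ _ u0 v0 cu cv okQ r.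
  - by rewrite (perm_mem pw).
  - by rewrite (perm_mem pw).
  by exists m' => //; apply: realizes_catC; rewrite -e'.
pose t0 := [:: inl 2, inr (a, true), inr (b, false) & W4 ++ [:: inl 4; inr (b, true)]].
case: c {okQ eQ} main => -[] [] main /=.
- pose v0 := W3 ++ inr (a, false) :: W2 ++ t0.
  case: (main (W1 ++ [:: inl 3]) (v0 ++ [:: inl 1]) [:: inl 1] (W1 ++ inl 3 :: v0)
    [:: inl 1; x] (W1 ++ inl 3 :: y :: v0)) => //.
  + by rewrite /v0; cat_nf.
  + by rewrite /v0; cat_nf.
  + by case: (W1).
  + by rewrite /v0; case: (W3).
  + by exists v0; rewrite cats1.
  + by exists W1; rewrite cats1.
  by move=> m' em' r'; exists m'.
- pose u := W1 ++ inl 3 :: W3 ++ inr (a, false) :: W2 ++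
    [:: inl 2, inr (a, true), inr (b, false) & W4].
  case: (main u [:: inl 4; inr (b, true); inl 1] [:: inl 1]
    (u ++ [:: inl 4; inr (b, true)]) [:: inl 1; x]
    (u ++ [:: y; inl 4; inr (b, true)])) => //.
  + by rewrite /frame /u; cat_nf.
  + by rewrite /u; cat_nf.
  + by rewrite /u; cat_nf.
  + by rewrite /u; case: (W1).
  + by exists [:: inl 4; inr (b, true)].
  + by exists [:: inr (b, true); inl 1].
  move=> m' em' r'; exists m' => //; move: r'.
  by rewrite /frame /u; cat_nf; rewrite cat_rcons.
- pose s := inl 1 :: W1 ++ [:: inl 3].
  case: (main (t0 ++ s) (W3 ++ inr (a, false) :: W2)
    (s ++ W3 ++ inr (a, false) :: W2) t0
    (s ++ y :: W3 ++ inr (a, false) :: W2 ++ [:: x]) t0) => //.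
  + by rewrite /frame /s; cat_nf.
  + by rewrite /s /t0; cat_nf.
  + by rewrite /s /t0; cat_nf.
  + by case: (W3).
  + by exists (inr (a, true) :: inr (b, false) :: W4 ++
      [:: inl 4; inr (b, true)] ++ s); rewrite /t0 /= -catA.
  + by exists (t0 ++ inl 1 :: W1); rewrite /s cats1 -rcons_cons rcons_cat.
  move=> m' em' r'; exists m' => //; move: r'.
  by rewrite /frame /s /t0; cat_nf; rewrite cat_rcons.
- pose s := inl 1 :: W1 ++ inl 3 :: W3 ++ inr (a, false) :: W2.
  case: (main [:: inl 2, inr (a, true), inr (b, false) & W4]
    ([:: inl 4; inr (b, true)] ++ s) s t0 (s ++ [:: x])
    ([:: inl 2, inr (a, true), inr (b, false) & W4] ++
      [:: y; inl 4; inr (b, true)])) => //.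
  + by rewrite /frame /s; cat_nf.
  + by rewrite /s /t0; cat_nf.
  + by rewrite /s /t0; cat_nf.
  + by eexists.
  + by eexists.
  move=> m' em' r'; exists m' => //; move: r'.
  by rewrite /frame /s /t0; cat_nf; rewrite !cat_rcons.
Qed.

Implicit Types (p q : seq (L * (bool * bool))).

Definition chosen (h : pred (bool * bool)) p : seq L :=
  [seq lc.1 | lc <- p & h lc.2].

Lemma chosen_rcons h p l c : chosen h (rcons p (l, c)) =
  if h c then rcons (chosen h p) l else chosen h p.
Proof. by rewrite /chosen filter_rcons /=; case: ifP; rewrite ?map_rcons. Qed.

Definition oriented e (ls : seq L) : seq (L * bool) := [seq (l, e) | l <- ls].

Definition ladder_part p (k : nat) : seq (L * bool) :=
  match k with
  | 1 => oriented false (rev (chosen (fun c => c.1) p))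
  | 2 => oriented false (chosen (fun c => ~~ c.1) p)
  | 3 => oriented true (rev (chosen (fun c => c.2) p))
  | _ => oriented true (chosen (fun c => ~~ c.2) p)
  end.

Definition slotted p : seq sym :=
  frame (map inr (ladder_part p 1)) (map inr (ladder_part p 2))
        (map inr (ladder_part p 3)) (map inr (ladder_part p 4)).

Definition ladder_word p : seq (L * bool) :=
  ladder_part p 1 ++ ladder_part p 3 ++ (a, false) :: ladder_part p 2 ++
  [:: (a, true), (b, false) & ladder_part p 4 ++ [:: (b, true)]].

Lemma slotted_rcons p l c :
    let x : sym := inr (l, false) in let y : sym := inr (l, true) in
  slotted (rcons p (l, c)) =
  frame (if c.1 then x :: map inr (ladder_part p 1) else map inr (ladder_part p 1))
    (if c.1 then map inr (ladder_part p 2)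
     else rcons (map inr (ladder_part p 2)) x)
    (if c.2 then y :: map inr (ladder_part p 3) else map inr (ladder_part p 3))
    (if c.2 then map inr (ladder_part p 4)
     else rcons (map inr (ladder_part p 4)) y).
Proof.
rewrite /slotted /= !chosen_rcons /oriented.
by case: c => -[] [] /=; rewrite ?rev_rcons ?map_rcons.
Qed.

Lemma mem_slotted p l e : inr (l, e) \in slotted p -> l \in [:: a, b & unzip1 p].
Proof.
have part k : (inr (l, e) : sym) \in (map inr (ladder_part p k) : seq sym) ->
    l \in [:: a, b & unzip1 p].
  case/mapP=> l' + [el]; subst l'; rewrite !inE => h.
  suff -> : l \in unzip1 p by rewrite !orbT.
  have ch g : l \in chosen g p -> l \in unzip1 p.
    by case/mapP=> lc; rewrite mem_filter => /andP[_ lcp] ->; apply: map_f.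
  have orient d s : (l, e) \in oriented d s -> l \in s by case/mapP=> ? ? [-> _].
  move: h; case: k => [|[|[|[|k]]]] /= /orient; rewrite ?mem_rev; exact: ch.
have : (l == a) || (l == b) -> l \in [:: a, b & unzip1 p].
  by rewrite !inE => /orP[]->; rewrite ?orbT.
move: (part 1) (part 2) (part 3) (part 4).
move: (l \in [:: a, b & unzip1 p]) => P p1 p2 p3 p4 pab.
rewrite /slotted /frame !(mem_cat, inE).
have inr_inl k : ((inr (l, e) : sym) == inl k) = false by [].
have inr_eq d f : ((inr (l, e) : sym) == inr (d, f)) = (l == d) && (e == f) by [].
rewrite !inr_inl !inr_eq /=.
case/orP=> [/p1//|/orP[/p3//|/orP[/andP[la _]|/orP[/p2//|]]]].
  by apply: pab; rewrite la.
case/or3P=> [/andP[lx _]|/andP[lx _]|/orP[/p4//|/andP[lx _]]];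
  by apply: pab; rewrite lx ?orbT.
Qed.

Fixpoint merges Q (cs : seq (bool * bool)) : nat :=
  if cs is c :: cs' then (trans Q c).1 + merges (trans Q c).2 cs' else 0.

Lemma slotted_run p q Q m : Q \in states -> uniq [:: a, b & unzip1 (p ++ q)] ->
    realizes (slotted p) Q m ->
  exists Q' m', m' + (merges Q (unzip2 q)).*2 = m + size q /\
    realizes (slotted (p ++ q)) Q' m'.
Proof.
elim: q p Q m => [|[l c] q IH] p Q m Qs uq rQ.
  by exists Q, m; rewrite cats0.
have lp e : (inr (l, e) : sym) \notin slotted p.
  apply/negP => /mem_slotted.
  move: uq; rewrite [unzip1 _]map_cat -2!cat_cons uniq_catC /= => /andP[+ _].
  by rewrite mem_cat negb_or => /andP[_ /negP h] /h.
have [m' em' r'] := frame_step c (lp false) (lp true) Qs rQ.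
have /and3P[_ _ Qs'] := trans_okP c Qs.
rewrite -cat_rcons in uq *; rewrite -slotted_rcons in r'.
have [Q' [m'' [em'' r'']]] := IH _ _ _ Qs' uq r'.
by exists Q', m''; split=> //=; move: em' em''; rewrite /=; lia.
Qed.

Lemma slotted_nil : a != b -> realizes (slotted [::]) start 3.
Proof.
move=> ab; exists [:: [:: inl 1; inl 3; inr (a, false); inr (b, false)];
  [:: inl 2; inr (a, true)]; [:: inl 4; inr (b, true)]]; split=> //.
have ba : (b == a) = false by rewrite eq_sym (negPf ab).
have inr_eq (d e : L * bool) : ((inr d : sym) == inr e) = (d == e) by [].
apply/and4P; split=> //.
- rewrite /slotted /frame /= !inE !inr_eq !xpair_eqE (negPf ab) /=.
  by rewrite !andbF.
- rewrite /slotted /frame /= !perm_cons.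
  by rewrite (permEl (perm_catCA [:: inr (b, false)]
    [:: inl 2; inr (a, true)] [:: inl 4; inr (b, true)])).
rewrite /traces /= !clinks_zip /slotted /frame /inv_letter /=.
by do ![apply/andP; split=> //]; rewrite !inE eqxx ?orbT.
Qed.

Lemma letters_slotted p : [seq s <- slotted p | is_letter s] =
  map inr (ladder_word p).
Proof.
have fid ls : [seq s <- (map inr ls : seq sym) | is_letter s] = map inr ls.
  by elim: ls => //= ? ? ->.
rewrite /slotted /frame /ladder_word.
rewrite /= !(filter_cat, fid) /= !(filter_cat, fid) /= !(filter_cat, fid) /=.
rewrite !(filter_cat, fid) /=.
by rewrite !map_cat /= ?map_cat /= ?map_cat.
Qed.

Lemma cycles_of_letters p C : cycles_of (slotted p) C ->
  exists2 C', cycles_of (map inr (ladder_word p)) C' & size C' = size C.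
Proof.
move/(cycles_of_del 1)/(cycles_of_del 2)/(cycles_of_del 3)/(cycles_of_del 4).
set C' := map _ (map _ _) => h; exists C'; last by rewrite !size_map.
pose P k := predC1 (inl k : sym).
suff -> : map inr (ladder_word p) =
  filter (P 4) (filter (P 3) (filter (P 2) (filter (P 1) (slotted p)))) by exact: h.
rewrite -letters_slotted -!filter_predI; apply/eq_in_filter => -[k|l] //.
rewrite /slotted /frame !(mem_cat, inE).
have nl (ls : seq (L * bool)) : ((inl k : sym) \in (map inr ls : seq sym)) = false.
  by elim: ls => //= d ls; rewrite inE.
rewrite !nl /=.
by case/or4P=> [/eqP[->]|/eqP[->]|/eqP[->]|/orP[/eqP[->]|//]].
Qed.

(** There are [size p + 2] edges, and the run leaves [size p + 3] vertices minus twice the number of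
    merges; Euler's formula then yields that number. *)
Lemma genus_ladder p : uniq [:: a, b & unzip1 p] ->
  genus (ladder_word p) = merges start (unzip2 p).
Proof.
move=> up; have ab : a != b by move: up; rewrite /= inE negb_or => /and3P[/andP[]].
have [Q [m [em [C [cyc sC _]]]]] := @slotted_run [::] p start 3 isT up (slotted_nil ab).
have [C' cyc' sC'] := cycles_of_letters cyc.
rewrite /genus (num_vertices_cycles cyc') sC' sC /num_edges.
have -> : size (ladder_word p) = (size p + 2).*2.
  rewrite /ladder_word !(size_cat, size_map, size_rev) /= size_cat !size_map /=.
  rewrite size_cat !size_map /= !size_filter.
  have /= c1 := count_predC (fun lc : L * (bool * bool) => lc.2.1) p.
  have /= c2 := count_predC (fun lc : L * (bool * bool) => lc.2.2) p.
  rewrite -[count (fun lc => ~~ lc.2.1) p]/(count (predC (fun lc => lc.2.1)) p).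
  rewrite -[count (fun lc => ~~ lc.2.2) p]/(count (predC (fun lc => lc.2.2)) p).
  lia.
by rewrite doubleK; lia.
Qed.

End Step.

Lemma genus_ladder9 n (KT : {set 'I_n} * {set 'I_n}) :
  genus (ladder9 KT) =
  merges start [tuple (k \in KT.1, k \in KT.2) | k < n].
Proof.
case: KT => K T /=.
pose p := [seq (let_ak k, (k \in K, k \in T)) | k <- enum 'I_n].
have enumE (A : {set 'I_n}) : enum A = [seq k <- enum 'I_n | k \in A].
  by rewrite enumT.
have eC A : [seq k <- enum 'I_n | k \in ~: A] = [seq k <- enum 'I_n | k \notin A].
  by apply: eq_filter => k; rewrite inE.
have -> : ladder9 (K, T) = ladder_word (let_a n) (let_b n) p.
  rewrite /ladder9 /R1 /R2 /R3 /R4 /= !enumE !eC.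
  rewrite /ladder_word /= /chosen /p !filter_map -!map_comp /oriented.
  by rewrite !map_rev -!map_comp.
rewrite genus_ladder.
  by rewrite /unzip2 -map_comp.
rewrite /unzip1 -map_comp /= inE /=; apply/and3P; split.
- by apply/negP => /mapP[].
- by apply/negP => /mapP[].
by rewrite map_inj_uniq ?enum_uniq // => k l [].
Qed.

(** * The generating function *)

Section GeneratingFunction.
Local Open Scope ring_scope.

Fixpoint genus_poly n (Q : seq (seq nat)) : {poly int} :=
  if n is m.+1 then
    \sum_(c <- choices) 'X^((trans Q c).1) * genus_poly m (trans Q c).2
  else 1.

Lemma sum_merges n Q :
  \sum_(t : n.-tuple (bool * bool)) 'X^(merges Q t) = genus_poly n Q.
Proof.
elim: n Q => [|n IH] Q /=.
  rewrite (big_pred1 [tuple]) ?expr0 // => t; rewrite /= tuple0.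
  by apply/esym/eqP.
rewrite (reindex (fun ct : (bool * bool) * n.-tuple (bool * bool) =>
  [tuple of ct.1 :: ct.2])) /=; last first.
  exists (fun t : n.+1.-tuple _ => (thead t, [tuple of behead t])) => [[c t] _|t _] /=.
    by congr (_, _); apply: val_inj.
  by rewrite -tuple_eta.
rewrite -(pair_big predT predT (fun c (t : n.-tuple _) => 'X^(merges Q (c :: t)))) /=.
rewrite (perm_big choices) /=; last first.
  by apply: uniq_perm => [||[[] []]]; rewrite ?index_enum_uniq // mem_index_enum.
apply: eq_bigr => c _; rewrite -IH big_distrr /=.
by apply: eq_bigr => t _; rewrite exprD.
Qed.

Lemma sum_genus n :
  \sum_(KT : {set 'I_n} * {set 'I_n}) 'X^(genus (ladder9 KT)) =
  genus_poly n start.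
Proof.
rewrite -sum_merges (reindex (fun KT : {set 'I_n} * {set 'I_n} =>
  [tuple (k \in KT.1, k \in KT.2) | k < n])).
  by apply: eq_bigr => KT _; rewrite genus_ladder9.
exists (fun t => ([set k | (tnth t k).1], [set k | (tnth t k).2])).
  by move=> [K T] _; congr (_, _); apply/setP => k; rewrite inE tnth_mktuple.
move=> t _; apply: eq_from_tnth => k; rewrite tnth_mktuple !inE.
by case: (tnth t k).
Qed.

Lemma coef_genus_poly n i : (genus_poly n start)`_i = (g9 n i)%:R.
Proof.
rewrite -sum_genus coef_sum /g9 -sum1dep_card natr_sum [RHS]big_mkcond /=.
by apply: eq_bigr => KT _; rewrite coefXn eq_sym; case: eqP.
Qed.

(* The coarsest partition of the states that is compatible with successors.    *)
Definition classes : seq nat :=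
  [:: 0; 1; 2; 2; 3; 4; 4; 0; 5; 6; 7; 5; 7; 8; 8; 9; 10; 9; 9; 9; 2; 2; 11; 12]%N.
Definition class_of Q := nth 0%N classes (index Q states).

(** Row [q] lists, for the four choices in some order, whether vertices merge and which class is
    reached. *)
Definition successors : seq (seq (bool * nat)) :=
  [:: [:: (false, 1); (true, 2); (true, 2); (true, 3)];
      [:: (true, 0); (true, 0); (true, 4); (true, 4)];
      [:: (false, 2); (false, 5); (true, 6); (true, 7)];
      [:: (false, 0); (false, 0); (true, 8); (true, 8)];
      [:: (false, 4); (true, 9); (true, 9); (true, 10)];
      [:: (true, 2); (true, 2); (true, 2); (true, 2)];
      [:: (false, 6); (false, 6); (false, 11); (false, 11)];
      [:: (false, 2); (false, 2); (false, 2); (false, 2)];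
      [:: (false, 8); (false, 9); (false, 9); (false, 10)];
      [:: (false, 4); (false, 4); (true, 8); (true, 8)];
      [:: (false, 10); (false, 10); (true, 12); (true, 12)];
      [:: (true, 6); (true, 6); (true, 6); (true, 6)];
      [:: (false, 10); (false, 10); (false, 10); (false, 10)]]%N.

Fixpoint class_poly n (q : nat) : {poly int} :=
  if n is m.+1 then
    \sum_(r <- nth [::] successors q) 'X^(r.1) * class_poly m r.2
  else 1.

Lemma genus_poly_class n Q : Q \in states ->
  genus_poly n Q = class_poly n (class_of Q).
Proof.
elim: n Q => //= n IH Q Qs.
have h : all (fun Q => perm_eq
    [seq ((trans Q c).1, class_of (trans Q c).2) | c <- choices]
    (nth [::] successors (class_of Q))) states by vm_compute.
rewrite -(perm_big _ (allP h Q Qs)) big_map /=; apply: eq_bigr => c _.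
by have /and3P[_ _ /IH ->] := trans_okP c Qs.
Qed.

Lemma class_polyS n q : class_poly n.+1 q =
  \sum_(r <- nth [::] successors q) 'X^(r.1) * class_poly n r.2.
Proof. by []. Qed.

Fixpoint lin_rec (c : int) n : {poly int} :=
  match n with
  | 0 => 0
  | 1 => 1
  | (m.+1 as k).+1 => c%:P * lin_rec c k + 8%:R * 'X * lin_rec c m
  end.

(** Classes 6 and 11 lead only to each other. Eliminating class 11 gives
    [P(n+2) = 2 P(n+1) + 8 X P(n)], the recurrence of [lin_rec 2]; classes 10 and 12 form a similar
    pair. *)
Lemma class_poly6 n :
  class_poly n 6 = lin_rec 2 n.+1 + 2%:R * lin_rec 2 n /\
  class_poly n 11 = lin_rec 2 n.+1 + (4%:R * 'X - 2%:R) * lin_rec 2 n.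
Proof.
elim: n => [|n [IH6 IH11]]; first by rewrite /= !mulr0 !addr0.
rewrite !class_polyS /= !big_cons !big_nil /= IH6 IH11 /=.
by split; ring.
Qed.

Lemma class_poly10 n :
  class_poly n 10 = lin_rec 2 n.+1 + 2%:R * 'X * lin_rec 2 n /\
  class_poly n 12 = lin_rec 2 n.+1 + 2%:R * lin_rec 2 n.
Proof.
elim: n => [|n [IH10 IH12]]; first by rewrite /= !mulr0 !addr0.
rewrite !class_polyS /= !big_cons !big_nil /= IH10 IH12 /=.
by split; ring.
Qed.

(** Eliminating classes 5 and 7 leaves the recurrence of [lin_rec 1], forced by [X] times class 6.
    As class 6 obeys the recurrence of [lin_rec 2], this forcing term, shifted by one step, is
    itself a particular solution. *)
Lemma class_poly2 n :
  class_poly n 2 = 'X * (lin_rec 2 n.+1 + 2%:R * lin_rec 2 n) +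
    (1 - 'X) * (lin_rec 1 n.+1 + lin_rec 1 n).
Proof.
suff [] : class_poly n 2 = 'X * (lin_rec 2 n.+1 + 2%:R * lin_rec 2 n) +
    (1 - 'X) * (lin_rec 1 n.+1 + lin_rec 1 n) /\
  class_poly n.+1 2 = 'X * (lin_rec 2 n.+2 + 2%:R * lin_rec 2 n.+1) +
    (1 - 'X) * (lin_rec 1 n.+2 + lin_rec 1 n.+1) by [].
have CS m : class_poly m.+2 2 = class_poly m.+1 2 + 8%:R * 'X * class_poly m 2 +
    'X * class_poly m.+1 6.
  rewrite ![class_poly m.+2 _]class_polyS !big_cons !big_nil /=.
  rewrite !big_cons !big_nil /=; ring.
elim: n => [|n [IH IH']].
  by rewrite !class_polyS /= !big_cons !big_nil /=; split; rewrite /=; ring.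
by split=> //; rewrite CS IH IH' (class_poly6 n.+1).1 /=; ring.
Qed.

(** Classes 4 and 8 enter class 0 only in this combination. It obeys the recurrence of [lin_rec 1]
    forced by [2 X] times class 10, and is solved like class 2. *)
Lemma class_poly48 n :
  class_poly n 4 + 'X * class_poly n 8 =
    2%:R * 'X * (lin_rec 2 n.+1 + 2%:R * 'X * lin_rec 2 n) +
    (1 - 'X) * (lin_rec 1 n.+1 + 4%:R * 'X * lin_rec 1 n).
Proof.
pose T := fun n => class_poly n 4 + 'X * class_poly n 8.
suff [] : T n = 2%:R * 'X * (lin_rec 2 n.+1 + 2%:R * 'X * lin_rec 2 n) +
    (1 - 'X) * (lin_rec 1 n.+1 + 4%:R * 'X * lin_rec 1 n) /\
  T n.+1 = 2%:R * 'X * (lin_rec 2 n.+2 + 2%:R * 'X * lin_rec 2 n.+1) +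
    (1 - 'X) * (lin_rec 1 n.+2 + 4%:R * 'X * lin_rec 1 n.+1) by [].
have TS m : T m.+2 = T m.+1 + 8%:R * 'X * T m + 2%:R * 'X * class_poly m.+1 10.
  rewrite /T ![class_poly m.+2 _]class_polyS !big_cons !big_nil /=.
  rewrite !big_cons !big_nil /=; ring.
elim: n => [|n [IH IH']].
  by rewrite /T !class_polyS /= !big_cons !big_nil /=; split; ring.
by split=> //; rewrite TS IH IH' (class_poly10 n.+1).1 /=; ring.
Qed.

(** The term [D(n)]: a solution of the homogeneous recurrence, coming from the two-step returns to
    class 0, of total weight [4 X]. *)
Fixpoint small_part n : {poly int} :=
  match n with
  | 0 => 1
  | 1 => 1 - 3%:R * 'X
  | m.+2 => 4%:R * 'X * small_part m
  end.

Lemma class_poly0 n :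
  class_poly n 0 = 6%:R * 'X^2 * lin_rec 2 n +
    6%:R * 'X * (1 - 'X) * lin_rec 1 n + small_part n.
Proof.
suff [] : class_poly n 0 = 6%:R * 'X^2 * lin_rec 2 n +
    6%:R * 'X * (1 - 'X) * lin_rec 1 n + small_part n /\
  class_poly n.+1 0 = 6%:R * 'X^2 * lin_rec 2 n.+1 +
    6%:R * 'X * (1 - 'X) * lin_rec 1 n.+1 + small_part n.+1 by [].
have CS m : class_poly m.+2 0 = 4%:R * 'X * class_poly m 0 +
    2%:R * 'X * (class_poly m 4 + 'X * class_poly m 8) +
    2%:R * 'X * class_poly m.+1 2.
  rewrite [LHS]class_polyS !big_cons !big_nil /=.
  rewrite !big_cons !big_nil /=; ring.
elim: n => [|n [IH IH']].
  by rewrite !class_polyS /= !big_cons !big_nil /=; split; rewrite /=; ring.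
by split=> //; rewrite CS IH class_poly48 class_poly2 /=; ring.
Qed.

End GeneratingFunction.

(** * Growth of the coefficients *)

(** The shallow diagonals of Pascal's triangle, which are the coefficients of Fibonacci-type
    polynomials. *)
Definition diag k j := 'C(k - j, j).

Lemma diagS k j : 2 * j < k ->
  j.+1 * (k - j) * diag k j.+1 = (k - 2 * j) * (k - 2 * j).-1 * diag k j.
Proof.
move=> jk; rewrite /diag.
have e1 := mul_bin_left (k - j.+1) j.
have e2 := mul_bin_down (k - j) j.
have -> : (k - 2 * j).-1 = k - j.+1 - j by lia.
have -> : (k - 2 * j) = k - j - j by lia.
rewrite (_ : (k - j).-1 = k - j.+1) in e2; last by lia.
by rewrite mulnAC e1 mulnAC -!mulnA [in RHS]mulnCA -e2; lia.
Qed.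

Lemma diag_gt0 k j : 2 * j <= k -> 0 < diag k j.
Proof. by move=> h; rewrite bin_gt0; lia. Qed.

Lemma diag_eq0 k j : k < 2 * j -> diag k j = 0.
Proof. by move=> h; rewrite /diag bin_small; lia. Qed.

(** For [n = k + 1], the coefficient at [X^(j+2)] without [small_part], divided by [6 * 8^j]; hence
    the factor 8 in the comparisons of neighbours. *)
Definition excess k j := (2 ^ (k - 2 * j) - 1) * diag k j + 8 * diag k j.+1.

(** With [q = 2^(k-2j-2)] the dominant terms are [4 q c0] and [8 q c1], so [c0 < 2 c1] is the point;
    the remaining [16 c1] is absorbed by [64 c2]. *)
Lemma excess_inc k j : 31 <= k -> 3 * j + 2 <= k -> excess k j < 8 * excess k j.+1.
Proof.
move=> k31 jk; pose e := k - 2 * j.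
have [ek je] : k = 2 * j + e /\ j + 2 <= e by lia.
have e7 : 7 <= e by lia.
have c0 : 0 < diag k j by apply: diag_gt0; lia.
have s0 := @diagS k j ltac:(lia); have s1 := @diagS k j.+1 ltac:(lia).
have Q4 : 2 ^ (k - 2 * j) = 4 * 2 ^ (k - 2 * j.+1).
  by rewrite -(expnD 2 2); congr (2 ^ _); lia.
have q1 : 0 < 2 ^ (k - 2 * j.+1) by rewrite expn_gt0.
rewrite /excess Q4; move: (2 ^ _) q1 => q q1 {Q4}.
move: c0 s0 s1; move: (diag k j) (diag k j.+1) (diag k j.+2) => c0 c1 c2 c0p.
have -> : (k - j) = j + e by lia.
have -> : (k - 2 * j) = e by lia.
have -> : (k - j.+1) = j + e - 1 by lia.
have -> : (k - 2 * j.+1) = e - 2 by lia.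
move=> s0 s1.
have h1 : c0 < 2 * c1.
  rewrite -(ltn_pmul2l (_ : 0 < j.+1 * (j + e))); last by lia.
  rewrite mulnCA s0.
  (* The bound [3 j + 2 <= k], that is [j + 2 <= e], is used here; at equality the sides are
     [2 (j+1)^2] and [2 (j+1) (j+2)]. *)
  have h : j.+1 * (j + e) < 2 * (e * e.-1).
    have [d ->] : exists d, e = d + j + 2 by exists (e - (j + 2)); lia.
    have -> : (d + j + 2).-1 = d + j + 1 by lia.
    by lia.
  by rewrite mulnA ltn_pmul2r.
have h2 : c1 <= 4 * c2.
  rewrite -(leq_pmul2l (_ : 0 < j.+2 * (j + e - 1))); last by rewrite muln_gt0; lia.
  rewrite mulnCA s1.
  have h : j.+2 * (j + e - 1) <= 4 * ((e - 2) * (e - 2).-1).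
    have h : j.+2 * (j + e - 1) <= e * (2 * e - 3) by apply: leq_mul; lia.
    apply: leq_trans h _.
    have [d ->] : exists d, e = d + 7 by exists (e - 7); lia.
    have -> : (d + 7 - 2).-1 = d + 4 by lia.
    have -> : d + 7 - 2 = d + 5 by lia.
    have -> : 2 * (d + 7) - 3 = 2 * d + 11 by lia.
    by lia.
  by rewrite mulnA leq_mul2r h orbT.
have h3 : q * c0.+1 <= q * (2 * c1) by rewrite leq_mul2l h1 orbT.
rewrite !mulnBl; lia.
Qed.

Lemma expn_ge_linear e : 7 <= e -> 18 * e < 2 ^ e + 9.
Proof.
move=> e7; rewrite -(subnK e7); elim: (e - 7) => // d IH.
by rewrite addSn expnS; lia.
Qed.

(** The claim amounts to [c0 + 8 q c1 + 64 c2 < 4 q c0 + 16 c1]. Now [c1 / c0 = v / u] is below one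
    half, by a margin of at least [e] in [u - 2 v]. For large [e] the power [4 q = 2^e] amplifies
    this margin; for small [e] the ratio itself is tiny. *)
Lemma excess_dec k j : 31 <= k -> 2 * j < k -> k < 3 * j + 2 ->
  8 * excess k j.+1 < excess k j.
Proof.
move=> k31 jk kj; pose e := k - 2 * j.
have [ek e1] : k = 2 * j + e /\ 0 < e by lia.
have je : e <= j + 1 by lia.
have c0 : 0 < diag k j by apply: diag_gt0; lia.
case: (ltnP 1 e) => [e2|]; last first.
  move=> e2; rewrite /excess (_ : k - 2 * j = 1); last by lia.
  by rewrite (@diag_eq0 k j.+1) ?(@diag_eq0 k j.+2) /=; lia.
have s0 := @diagS k j ltac:(lia).
have Q4 : 2 ^ (k - 2 * j) = 4 * 2 ^ (k - 2 * j.+1).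
  by rewrite -(expnD 2 2); congr (2 ^ _); lia.
have q1 : 0 < 2 ^ (k - 2 * j.+1) by rewrite expn_gt0.
have s1 : j.+2 * (k - j.+1) * diag k j.+2 =
    (k - 2 * j.+1) * (k - 2 * j.+1).-1 * diag k j.+1.
  case: (ltnP (2 * j.+1) k) => h; first exact: diagS.
  have z : k - 2 * j.+1 = 0 by lia.
  by rewrite (@diag_eq0 k j.+2) ?z ?muln0 //; lia.
have Qe : 7 <= e -> 18 * e < 4 * 2 ^ (k - 2 * j.+1) + 9.
  by move=> h; rewrite -Q4 (_ : k - 2 * j = e) ?expn_ge_linear //; lia.
rewrite /excess Q4; move: (2 ^ _) q1 Qe => q q1 Qe {Q4}.
move: c0 s0 s1; move: (diag k j) (diag k j.+1) (diag k j.+2) => c0 c1 c2 c0p.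
have -> : (k - j) = j + e by lia.
have -> : (k - 2 * j) = e by lia.
have -> : (k - j.+1) = j + e - 1 by lia.
have -> : (k - 2 * j.+1) = e - 2 by lia.
move=> s0 s1.
have [u eu] : exists u, u = j.+1 * (j + e) by eexists.
have [v ev] : exists v, v = e * e.-1 by eexists.
rewrite -eu -ev in s0.
have uv : 2 * v + e <= u.
  rewrite eu ev; have [f ef] : exists f, e = f.+1 by exists e.-1; lia.
  have [d ->] : exists d, j = d + f by exists (j - f); lia.
  by rewrite ef /=; lia.
have h2 : 2 * c2 <= c1.
  rewrite -(leq_pmul2l (_ : 0 < j.+2 * (j + e - 1))); last by rewrite muln_gt0; lia.
  rewrite mulnCA s1 mulnA leq_mul2r; apply/orP; right.
  by rewrite mulnCA leq_mul //; lia.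
have u0 : 0 < u by rewrite eu muln_gt0; lia.
(* Multiplying by [u] and using [u c1 = v c0] reduces the comparison to [u] and [v]. *)
have ltc m : m * u < 4 * q * (u - 2 * v) -> m * c0 + 8 * q * c1 < 4 * q * c0.
  move=> h; rewrite -(ltn_pmul2r u0) mulnDl.
  have -> : 8 * q * c1 * u = 8 * q * v * c0.
    by rewrite -!mulnA [c1 * u]mulnC s0.
  rewrite !(mulnAC _ c0) -mulnDl ltn_pmul2r //.
  move: h; rewrite mulnBr mulnA [4 * q * 2]mulnAC.
  move: (m * u) (4 * q * u) => x y; lia.
have qc1 : c1 <= q * c1 by rewrite leq_pmull.
have h1 : 2 * c1 <= c0.
  rewrite -(leq_pmul2l u0) mulnCA s0 mulnA leq_mul2r; apply/orP; right; lia.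
(* For [e >= 7], [64 c2 <= 32 c1] and [16 c1 <= 8 c0] leave the case [m = 9], which follows from
   [2^e > 18 e - 9]. *)
case: (ltnP 6 e) => e6.
  have h : 9 * u < 4 * q * (u - 2 * v).
    have [w ew] : exists w, u = 2 * v + w by exists (u - 2 * v); lia.
    rewrite ew addKn; have we : e <= w by lia.
    have h : (18 * e - 17) * e <= (4 * q - 9) * w by apply: leq_mul; move: (Qe e6); lia.
    have e18 : (18 * e - 17) * e = 18 * v + e.
      rewrite ev; have [f ->] : exists f, e = f.+1 by exists e.-1; lia.
      have -> : 18 * f.+1 - 17 = 18 * f + 1 by lia.
      by rewrite /=; lia.
    rewrite e18 mulnBl in h; lia.
  by have := ltc _ h; rewrite !mulnBl; lia.
(* Here [e <= 6] and [2 j + e >= 31]. Then [64 c2 <= 16 c1] leaves only the case [m = 1]. *)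
have j13 : 13 <= j by lia.
have h4 : 4 * c2 <= c1.
  rewrite -(leq_pmul2l (_ : 0 < j.+2 * (j + e - 1))); last by rewrite muln_gt0; lia.
  rewrite mulnCA s1 mulnA leq_mul2r; apply/orP; right.
  have a1 : 15 * 14 <= j.+2 * (j + e - 1) by apply: leq_mul; lia.
  have a2 : (e - 2) * (e - 2).-1 <= 4 * 3 by apply: leq_mul; lia.
  lia.
have h5 : 1 * u < 4 * q * (u - 2 * v).
  have a1 : 14 * 15 <= u by rewrite eu; apply: leq_mul; lia.
  have a2 : v <= 6 * 5 by rewrite ev; apply: leq_mul; lia.
  apply: (@leq_trans (4 * (u - 2 * v))); first by lia.
  by rewrite leq_mul2r; apply/orP; right; lia.
by have := ltc _ h5; rewrite !mulnBl; lia.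
Qed.

(** * Coefficients of the generating function *)

Section Coefficients.
Local Open Scope ring_scope.

Lemma diag_pascal n j : diag n.+2 j.+1 = (diag n.+1 j.+1 + diag n j)%N.
Proof.
rewrite /diag !subSS; case: (leqP j n) => jn; first by rewrite subSn // binS.
by rewrite !bin_small; lia.
Qed.

Lemma coef_natXM m (p : {poly int}) i :
  (m%:R * 'X * p)`_i = m%:R * (if i is j.+1 then p`_j else 0).
Proof.
rewrite -mulrA mulr_natl coefMn coefXM. by rewrite [RHS]mulr_natl; case: i.
Qed.

Lemma coef_lin_rec c n i :
  (lin_rec c n.+1)`_i = c ^+ (n - 2 * i) * 8%:R ^+ i * (diag n i)%:R.
Proof.
suff [] : (lin_rec c n.+1)`_i = c ^+ (n - 2 * i) * 8%:R ^+ i * (diag n i)%:R /\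
  (lin_rec c n.+2)`_i = c ^+ (n.+1 - 2 * i) * 8%:R ^+ i * (diag n.+1 i)%:R by [].
elim: n i => [|n IH] i.
  split; first by case: i => [|i]; rewrite /= coef1 /diag ?bin0 ?mulr1 ?mulr0.
  rewrite /= mulr0 addr0 mulr1 coefC /diag; case: i => [|[|i]] //=.
    by rewrite bin0 !mulr1.
  by rewrite bin_small ?mulr0 //; lia.
split; first by case: (IH i).
rewrite [lin_rec c n.+3]/= -/(lin_rec c n.+2) -/(lin_rec c n.+1).
rewrite coefD coefCM coef_natXM (IH i).2; case: i => [|j].
  by rewrite mulr0 addr0 /diag !bin0 !muln0 !subn0 [in RHS]exprS !mulrA.
rewrite (IH j).1 diag_pascal natrD mulrDr; congr (_ + _); last first.
  by rewrite exprS (_ : (n.+2 - 2 * j.+1 = n - 2 * j)%N); [ring | lia].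
case: (ltnP n.+1 (2 * j.+1)) => h; first by rewrite diag_eq0 ?mulr0.
by rewrite !mulrA -exprS (_ : (n.+2 - 2 * j.+1 = (n.+1 - 2 * j.+1).+1)%N); last lia.
Qed.

(** [small_part] is [(4 X)^m] or [(4 X)^m (1 - 3 X)]; the factor 4 keeps the lower bound
    [-3 * 4^(i-1)] integral at [i = 0]. *)
Lemma small_part_bounds n i :
  - (3%:R * 4%:R ^+ i) <= 4%:R * (small_part n)`_i <= 4%:R ^+ i.+1.
Proof.
have e4 m : 0 <= 4%:R ^+ m :> int by apply: exprn_ge0.
suff H m : (- (3%:R * 4%:R ^+ i) <= 4%:R * (small_part m)`_i <= 4%:R ^+ i.+1) /\
  (- (3%:R * 4%:R ^+ i) <= 4%:R * (small_part m.+1)`_i <= 4%:R ^+ i.+1).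
  by case: (H n).
elim: m i => [|m IH] i.
  rewrite /= coefB coef1 [3%:R * 'X]mulr_natl coefMn coefX.
  have := e4 i; have := e4 i.+1; case: i => [|[|i]] //=; lia.
split; first by case: (IH i).
rewrite [small_part m.+2]/= coef_natXM; case: i => [|i]; first by rewrite !mulr0.
by have [+ _] := IH i; rewrite ![4%:R ^+ _.+1]exprS; lia.
Qed.

Lemma small_part_eq0 n i : (2 * i + 1 < n)%N || (n.+1 < 2 * i)%N ->
  (small_part n)`_i = 0.
Proof.
suff [] : ((2 * i + 1 < n)%N || (n.+1 < 2 * i)%N ->
   (small_part n)`_i = 0) /\ ((2 * i + 1 < n.+1)%N || (n.+2 < 2 * i)%N ->
   (small_part n.+1)`_i = 0) by [].
elim: n i => [|n IH] i.
  rewrite /= coefB coef1 mulr_natl coefMn coefX.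
  by case: i => [|[|i]] //=; rewrite ?mul0rn ?subr0.
split; first by case: (IH i).
rewrite [small_part n.+2]/= coef_natXM; case: i => [|i] h; first by rewrite mulr0.
by rewrite (IH i).1 ?mulr0 //; move: h; lia.
Qed.

Lemma g9E n i : (g9 n i)%:R = (6%:R * 'X^2 * lin_rec 2 n +
    6%:R * 'X * (1 - 'X) * lin_rec 1 n + small_part n)`_i :> int.
Proof. by rewrite -class_poly0 -coef_genus_poly genus_poly_class. Qed.

Lemma g9_0 n : (2 <= n)%N -> g9 n 0 = 0%N.
Proof.
move=> n2; suff : (g9 n 0)%:R = 0 :> int by lia.
rewrite g9E !coefD -!mulrA !mulr_natl !coefMn !coefXM /=.
by rewrite small_part_eq0 // muln0 n2.
Qed.

Lemma g9_1 k : (3 <= k)%N -> g9 k.+1 1 = 6%N.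
Proof.
move=> k3; suff : (g9 k.+1 1)%:R = 6%:R :> int by lia.
rewrite g9E coefD small_part_eq0 ?addr0; last by lia.
rewrite coefD -!mulrA !mulr_natl !coefMn !coefXM /=.
rewrite mulrBl mul1r coefB coefXM /= subr0 coef_lin_rec expr1n mul1r /diag.
by rewrite bin0 mul0rn add0r.
Qed.

Lemma g9_SS k j : (g9 k.+1 j.+2)%:R =
  6%:R * 8%:R ^+ j * (excess k j)%:R + (small_part k.+1)`_j.+2 :> int.
Proof.
rewrite g9E coefD; congr (_ + _).
rewrite coefD -!mulrA !mulr_natl !coefMn !coefXM /=.
rewrite mulrBl mul1r coefB coefXM /= !coef_lin_rec !expr1n !mul1r.
rewrite /excess natrD !natrM natrB ?expn_gt0 // natrX.
by rewrite exprS; ring.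
Qed.

End Coefficients.

(** * Small rows by computation *)

Section Represent.
Local Open Scope Z_scope.

(** Coefficient lists over [Z], lowest degree first, mirror the recurrences in a form that
    [vm_compute] can evaluate. *)
Fixpoint padd (s t : seq Z) : seq Z :=
  match s, t with
  | x :: s', y :: t' => (x + y) :: padd s' t'
  | [::], _ => t
  | _, [::] => s
  end.
Definition pscale (c : Z) (s : seq Z) : seq Z := [seq c * x | x <- s].

Fixpoint lin_pair (c : Z) n : seq Z * seq Z :=
  if n is m.+1 then
    let: (s, t) := lin_pair c m in (t, padd (pscale c t) (0 :: pscale 8 s))
  else ([::], [:: 1]).

Fixpoint small_pair n : seq Z * seq Z :=
  if n is m.+1 then let: (s, t) := small_pair m in (t, 0 :: pscale 4 s)
  else ([:: 1], [:: 1; -3]).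

Definition row9 n : seq Z :=
  let s := (lin_pair 2 n).1 in let t := pscale 6 (lin_pair 1 n).1 in
  padd (padd (0 :: 0 :: pscale 6 s) (padd (0 :: t) (0 :: 0 :: pscale (-1) t)))
    (small_pair n).1.

Definition represents (s : seq Z) (p : {poly int}) :=
  forall i, Z_of_int p`_i%R = nth 0 s i.

Lemma nth_padd s t i : nth 0 (padd s t) i = nth 0 s i + nth 0 t i.
Proof. by elim: s t i => [|x s IH] [|y t] [|i] //=; rewrite ?nth_nil; lia. Qed.

Lemma nth_pscale c s i : nth 0 (pscale c s) i = c * nth 0 s i.
Proof. by elim: s i => [|x s IH] [|i] //=; lia. Qed.

Lemma represents_add s t p q : represents s p -> represents t q ->
  represents (padd s t) (p + q)%R.
Proof. by move=> sp tq i; rewrite coefD rmorphD nth_padd -sp -tq. Qed.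

Lemma represents_scale (c : int) s p : represents s p ->
  represents (pscale (Z_of_int c) s) (c%:P * p)%R.
Proof. by move=> sp i; rewrite coefCM rmorphM nth_pscale -sp. Qed.

Lemma represents_shift s p : represents s p -> represents (0 :: s) ('X * p)%R.
Proof. by move=> sp [|i]; rewrite coefXM //=; apply: sp. Qed.

Lemma lin_pairP (c : int) n : let: (s, t) := lin_pair (Z_of_int c) n in
  represents s (lin_rec c n) /\ represents t (lin_rec c n.+1).
Proof.
elim: n => [|n] /=.
  by split=> -[|i]; rewrite ?coef0 ?coef1 //= ?nth_nil.
case: (lin_pair _ n) => s t [hs ht]; split=> //.
apply: represents_add; first exact: represents_scale.
rewrite -mulrA (mulrCA _ 'X)%R; apply: represents_shift.
by by rewrite -polyC_natr; apply: (represents_scale 8%:R).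
Qed.

Lemma small_pairP n : let: (s, t) := small_pair n in
  represents s (small_part n) /\ represents t (small_part n.+1).
Proof.
elim: n => [|n] /=.
  split=> -[|[|i]]; rewrite ?coefB ?coef1 ?[(3%:R * 'X)%R]mulr_natl ?coefMn ?coefX
    //= ?nth_nil //.
case: (small_pair n) => s t [hs ht]; split=> //.
rewrite -mulrA (mulrCA _ 'X)%R; apply: represents_shift.
by rewrite -polyC_natr; apply: (represents_scale 4%:R).
Qed.

Lemma row9P n i : Z_of_int ((g9 n i)%:R)%R = nth 0 (row9 n) i.
Proof.
have h2 := lin_pairP 2%:R n; have h1 := lin_pairP 1 n; have h0 := small_pairP n.
rewrite g9E /row9; move: h2 h1 h0.
rewrite -[2]/(Z_of_int 2%:R) -[1]/(Z_of_int 1).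
case: (lin_pair _ n) => s2 t2 [h2 _]; case: (lin_pair _ n) => s1 t1 [h1 _].
case: (small_pair n) => s0 t0 [h0 _]; rewrite ![(_, _).1]/=.
move: i; apply: (represents_add _ h0).
have -> : (6%:R * 'X^2 * lin_rec 2 n + 6%:R * 'X * (1 - 'X) * lin_rec 1 n =
  'X * ('X * (6%:P * lin_rec 2 n)) +
  ('X * (6%:P * lin_rec 1 n) + 'X * ('X * ((-1)%:P * (6%:P * lin_rec 1 n)))))%R.
  ring.
have h6 := represents_scale 6%:R h1.
apply: represents_add; last apply: represents_add.
- by do 2!apply: represents_shift; apply: (represents_scale 6%:R).
- exact: represents_shift.
by do 2!apply: represents_shift; apply: (represents_scale (- 1)).
Qed.

(** Stated over all genera, so that the extreme genera need not be determined. The second condition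
    forces [p > 0]. *)
Definition peaked_at (f : nat -> nat) (p : nat) : Prop :=
  [/\ forall i, (i < p)%N -> (f i <= f i.+1)%N, (f p.-1 < f p)%N, (f p.+1 < f p)%N &
      forall i, (p <= i)%N -> (f i.+1 <= f i)%N].

Definition row_peaked (s : seq Z) (p : nat) : bool :=
  [&& all (fun i => nth 0 s i <=? nth 0 s i.+1) (iota 0 p),
      nth 0 s p.-1 <? nth 0 s p, nth 0 s p.+1 <? nth 0 s p &
      all (fun i => nth 0 s i.+1 <=? nth 0 s i) (iota p (size s))].

Lemma row_peakedP n p : row_peaked (row9 n) p -> peaked_at (g9 n) p.
Proof.
have le i j : nth 0 (row9 n) i <=? nth 0 (row9 n) j -> (g9 n i <= g9 n j)%N.
  by rewrite -!row9P; lia.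
have lt i j : nth 0 (row9 n) i <? nth 0 (row9 n) j -> (g9 n i < g9 n j)%N.
  by rewrite -!row9P; lia.
case/and4P=> /allP h1 /lt h2 /lt h3 /allP h4; split=> // i ip.
  by apply/le/h1; rewrite mem_iota.
(* Beyond the tested range both entries are the default 0. *)
case: (ltnP i (p + size (row9 n))) => h; first by apply/le/h4; rewrite mem_iota ip.
by apply: le; rewrite !nth_default //; lia.
Qed.

Lemma peaked_small n : (2 <= n < 32)%N -> peaked_at (g9 n) (p9 n).
Proof.
move=> h; apply: row_peakedP.
have : all (fun n => row_peaked (row9 n) (p9 n)) (iota 2 30) by vm_compute.
by move/allP; apply; rewrite mem_iota.
Qed.

End Represent.

(** * Large rows and the conclusion *)

Lemma g9_inc k j : 31 <= k -> 3 * j + 2 <= k -> g9 k.+1 j.+2 < g9 k.+1 j.+3.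
Proof.
move=> k31 jk; have lt := excess_inc k31 jk.
(* Both degrees lie below the support of [small_part]. *)
have := g9_SS k j; have := g9_SS k j.+1; rewrite exprS !small_part_eq0 ?addr0; try lia.
have : (0 < 8 ^ j)%N by rewrite expn_gt0.
rewrite -natrX; move: (8 ^ j) => q q0 h1 h2.
have : q * (excess k j).+1 <= q * (8 * excess k j.+1) by rewrite leq_mul2l lt orbT.
move: h1 h2; lia.
Qed.

Lemma expn_2_large j : 4 <= j -> 16 * 4 ^ j <= 8 ^ j.
Proof.
by move=> j4; rewrite (expnMn 2 4) leq_pmul2r ?expn_gt0 // (@leq_exp2l 2 4).
Qed.

Lemma g9_dec k j : 31 <= k -> 2 * j < k -> k < 3 * j + 2 ->
  g9 k.+1 j.+3 < g9 k.+1 j.+2.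
Proof.
move=> k31 jk kj; have lt := excess_dec k31 jk kj.
have /andP[+ _] := small_part_bounds k.+1 j.+2.
have /andP[_ +] := small_part_bounds k.+1 j.+3.
have := g9_SS k j; have := g9_SS k j.+1.
move: ((small_part _)`_j.+3)%R ((small_part _)`_j.+2)%R => d1 d0.
rewrite !exprS -!natrX.
(* The main terms drop by at least [6 * 8^j >= 96 * 4^j], while [small_part] contributes at most
   [64 * 4^j + 12 * 4^j]. *)
have q16 : 16 * 4 ^ j <= 8 ^ j by apply: expn_2_large; lia.
have r0 : 0 < 4 ^ j by rewrite expn_gt0.
move: (8 ^ j) (4 ^ j) q16 r0 => q r qr r0 h1 h2 h3 h4.
have : q * (8 * excess k j.+1).+1 <= q * excess k j by rewrite leq_mul2l lt orbT.
move: h1 h2 h3 h4; rewrite mulnS; lia.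
Qed.

Lemma g9_eq0 k j : k <= 2 * j -> g9 k.+1 j.+3 = 0.
Proof.
move=> kj; have := g9_SS k j.+1; rewrite small_part_eq0 ?addr0; last by lia.
rewrite /excess (_ : k - 2 * j.+1 = 0); last by lia.
by rewrite (@diag_eq0 k j.+2) ?muln0 /=; lia.
Qed.

Lemma peaked_large n : 32 <= n -> peaked_at (g9 n) (p9 n).
Proof.
case: n => // k k31; have [k31' nle8 nn9] : [/\ 31 <= k, (k.+1 <= 8) = false & (k.+1 == 9) = false].
  by split; lia.
rewrite /p9 nle8 nn9; have e := divn_eq k.+1 3; have r := ltn_pmod k.+1 (isT : 0 < 3).
(* With [k = 3 J + r - 1] and [r < 3], the condition [3 j + 2 <= k] holds for [j = J - 1] and fails
   for [j = J], which puts the peak at [J + 2]. *)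
move: (k.+1 %/ 3) (k.+1 %% 3) e r => J r e r3; rewrite addn2.
split.
- move=> [|[|j]] h; first by rewrite g9_0 //; lia.
    rewrite g9_1; last by lia.
    have := g9_SS k 0; rewrite small_part_eq0; last by lia.
    have : 0 < excess k 0.
      by rewrite /excess muln0 subn0 /diag bin0 -(subnK k31') expnD; lia.
    rewrite expr0; lia.
  by apply/ltnW/g9_inc; lia.
- by case: J e => [|J] e; [lia | apply: g9_inc; lia].
- by apply: g9_dec; lia.
move=> [|[|j]] h; try lia.
case: (ltnP (2 * j) k) => jk; last by rewrite g9_eq0.
by apply/ltnW/g9_dec; lia.
Qed.

Lemma is_peak_peaked f p q r : peaked_at f p -> q <= p <= r -> is_peak f q r p.
Proof.
case=> h1 h2 h3 h4 /andP[qp pr]; split=> //.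
- split=> // i _ h; apply: h1; lia.
- by move=> i pi ip; congr f; lia.
by split=> // i pi _; apply: h4; apply: ltnW.
Qed.

Theorem theorem3p15 (n : nat) (hn : 2 <= n) :
  unimodal (g9 n) (min_genus9 n) (max_genus9 n) /\
  is_peak (g9 n) (min_genus9 n) (max_genus9 n) (p9 n).
Proof.
have pk : peaked_at (g9 n) (p9 n).
  by case: (ltnP n 32) => h; [apply: peaked_small; rewrite hn | apply: peaked_large].
suff peak : is_peak (g9 n) (min_genus9 n) (max_genus9 n) (p9 n).
  by split=> //; exists (p9 n), (p9 n).
apply: is_peak_peaked => //.
(* A positive count provides a surface of genus [p9 n], which bounds the peak by the extreme
   genera. *)
have : 0 < g9 n (p9 n) by case: pk => _ h _ _; apply: leq_ltn_trans h.
rewrite /g9 card_gt0 => /set0Pn[KT]; rewrite inE => /eqP <-.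
rewrite /min_genus9 /max_genus9.
case: arg_minnP => // KT1 _ -> //; case: arg_maxnP => // KT2 _ h.
exact: h.
Qed.
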